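(* Let $h_I>0$, $\mu>0$, $b\in(0,1)$, $x_0\in[0,1)$, and let $\gamma(\xi)=(\cos\xi+x_0,\ b\sin\xi)$, $\xi\in[0,2\pi]$, be the parameterisation of an ellipse with eccentricity $e=\sqrt{1-b^2}$, semimajor axis equal to $1$ and centre on the (nonnegative) $x$-axis. Consider the reflective Keplerian billiard inside this ellipse, with the mass at the origin. Then the central configuration $\bar\xi=0$ is always unstable, while the stability of the central configuration $\bar\xi=\pi$ depends on the sign of the quantity $$C_\pi=\left(\frac{b^2}{1-x_0}-1\right)\left(\frac{b^2}{1-x_0}-1-\frac{b^2\mu}{2(1-x_0)^2}\,\frac{1}{V_I(\gamma(\pi))}\right),\qquad V_I(\gamma(\pi))=h_I+\frac{\mu}{1-x_0},$$ in the sense that: - if $C_\pi>0$, then $\bar\xi=\pi$ is unstable; - if $C_\pi<0$, then $\bar\xi=\pi$ is stable. The stability of $0$ and $\pi$ swaps when $x_0\in(-1,0]$: in that case $\bar\xi=\pi$ is always unstable, and $\bar\xi=0$ is unstable (resp. stable) if the quantity obtained from $C_\pi$ by replacing $x_0$ with $-x_0$, namely $$\left(\frac{b^2}{1+x_0}-1\right)\left(\frac{b^2}{1+x_0}-1-\frac{b^2\mu}{2(1+x_0)^2}\,\frac{1}{V_I(\gamma(0))}\right),\qquad V_I(\gamma(0))=h_I+\frac{\mu}{1+x_0},$$ is positive (resp. negative).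
   Context: Reflective Keplerian billiard: let $D$ be the bounded region enclosed by the closed curve $\gamma$, with the origin in its interior. Inside $D$ the particle moves under $V_I(z)=h_I+\frac{\mu}{|z|}$, that is $z''=\nabla V_I(z)$ with energy relation $\frac12|z'|^2-V_I(z)=0$ ($h_I>0$ is the inner energy, $\mu>0$ the mass parameter). Collisions with the origin are regularised by the Levi-Civita regularisation, so that a particle moving radially into the mass is reflected back along the same half-line. When an arc hits $\partial D$ it is reflected elastically (the tangent component of the velocity is kept, the normal one changes sign). Initial conditions of inner arcs at the given energy are described by $(\xi,\alpha)\in[0,2\pi)\times(-\frac{\pi}{2},\frac{\pi}{2})$ ($\xi$ modulo $2\pi$), where $\gamma(\xi)$ is the starting point and $\alpha$ is the angle from the inward-pointing normal at $\gamma(\xi)$ to the initial velocity. The first return map $F:(\xi_0,\alpha_0)\mapsto(\xi_1,\alpha_1)$ sends the initial conditions of an inner arc to the initial conditions of the next inner arc, obtained after the reflection at the next boundary point $\gamma(\xi_1)$. A central configuration is a parameter $\bar\xi$ such that the vector $\gamma(\bar\xi)$ is orthogonal to $\partial D$ at $\gamma(\bar\xi)$ and the half-line from the origin through $\gamma(\bar\xi)$ meets $\partial D$ only at $\gamma(\bar\xi)$. Then $(\bar\xi,0)$ is a fixed point of $F$ and corresponds to a homothetic trajectory along that half-line. For the ellipse in the claim, $\bar\xi=0$ and $\bar\xi=\pi$ are central configurations. Stability is meant in the linear sense for the fixed point $(\bar\xi,0)$ of $F$. The Jacobian $DF(\bar\xi,0)$ has determinant $1$; let $\Delta=\big(\mathrm{tr}\,DF(\bar\xi,0)\big)^2-4$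 be the discriminant of its characteristic polynomial. The central configuration $\bar\xi$ is called unstable if $\Delta>0$ (the eigenvalues are real and distinct, $\lambda$ and $\lambda^{-1}$: a saddle), and stable if $\Delta<0$ (the eigenvalues are complex conjugate, non-real and of modulus one: a centre). *)

(* Defs.v *)
(* The plane is Coquelicot's [C = R * R], so that the Levi-Civita map is the
   complex square. *)
From Stdlib Require Import Reals.
From Coquelicot Require Import Coquelicot.
Open Scope R_scope.

Definition dot (u v : C) : R := fst u * fst v + snd u * snd v.

Definition V_I (hI mu : R) (z : C) : R := hI + mu / Cmod z.

Definition grad (V : C -> R) (z : C) : C :=
  (Derive (fun x => V (x, snd z)) (fst z),
   Derive (fun y => V (fst z, y)) (snd z)).

(* Off collisions [z] is a solution of Newton's equation with velocity [v] on the
   zero energy level; the values of [v] at collision times carry no meaning. *)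
Definition newton_motion (hI mu : R) (z v : R -> C) : Prop :=
  forall t, z t <> 0%C ->
    is_derive z t (v t) /\
    is_derive v t (grad (V_I hI mu) (z t)) /\
    Cmod (v t) ^ 2 / 2 - V_I hI mu (z t) = 0.

(* Levi-Civita regularisation: z = w^2 with the fictitious time s given by
   dt = |z| ds = |w|^2 ds.  On the energy level of [newton_motion] the equation
   becomes w'' = (hI / 2) w, which is regular at w = 0 and is imposed there too;
   this is what prescribes the motion after a collision. *)
Definition levi_civita (hI : R) (z : R -> C) : Prop :=
  exists (w w' : R -> C) (tm : R -> R),
    (forall s, is_derive w s (w' s) /\
               is_derive w' s (RtoC (hI / 2) * w s)%C /\
               is_derive tm s (Cmod (w s) ^ 2) /\
               z (tm s) = (w s * w s)%C) /\
    (forall t, exists s, tm s = t).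

(* Since hI > 0 such motions are defined for all times; an inner arc is the
   restriction of one of them to the time interval it spends in the domain. *)
Definition inner_motion (hI mu : R) (z v : R -> C) : Prop :=
  newton_motion hI mu z v /\ levi_civita hI z.

(* From here on, [gamma] is a counterclockwise closed curve bounding [D]. *)

Definition tangent (gamma : R -> C) (xi : R) : C :=
  (Derive (fun x => fst (gamma x)) xi, Derive (fun x => snd (gamma x)) xi).

(* Multiplication by i turns the tangent to the left, i.e. towards the interior
   for a counterclockwise parameterisation. *)
Definition inward_normal (gamma : R -> C) (xi : R) : C :=
  (Ci * tangent gamma xi / RtoC (Cmod (tangent gamma xi)))%C.

(* Velocity at [gamma xi], on the energy level, making the angle [alpha],
   counted counterclockwise, with the inward normal. *)
Definition launch (hI mu : R) (gamma : R -> C) (xi alpha : R) : C :=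
  (RtoC (sqrt (2 * V_I hI mu (gamma xi)))
   * ((cos alpha, sin alpha) * inward_normal gamma xi))%C.

Definition reflect (gamma : R -> C) (xi : R) (v : C) : C :=
  let n := inward_normal gamma xi in (v - RtoC (2 * dot v n) * n)%C.

(* [first_return hI mu gamma D (xi0, alpha0) (xi1, alpha1)]: graph of the first
   return map; [xi1] may be any representative modulo 2 pi. *)
Definition first_return (hI mu : R) (gamma : R -> C) (D : C -> Prop)
    (p q : R * R) : Prop :=
  - (PI / 2) < snd p < PI / 2 /\ - (PI / 2) < snd q < PI / 2 /\
  exists (z v : R -> C) (T : R),
    inner_motion hI mu z v /\ 0 < T /\
    z 0 = gamma (fst p) /\ v 0 = launch hI mu gamma (fst p) (snd p) /\
    (forall t, 0 < t < T -> D (z t)) /\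
    z T = gamma (fst q) /\
    reflect gamma (fst q) (v T) = launch hI mu gamma (fst q) (snd q).

(* [F] is the first return map around [(xi, 0)], with the angle [xi1] lifted to
   the interval of length 2 pi centred at [xi].  The equivalence says that [F] is
   defined, and the first return unique, at every point of a neighbourhood. *)
Definition return_map_near (hI mu : R) (gamma : R -> C) (D : C -> Prop)
    (xi : R) (F : R * R -> R * R) : Prop :=
  locally ((xi, 0) : R * R) (fun p => forall q,
    (first_return hI mu gamma D p q /\ Rabs (fst q - xi) < PI) <-> q = F p).

Definition central_configuration (gamma : R -> C) (xi : R) : Prop :=
  dot (gamma xi) (tangent gamma xi) = 0 /\
  forall r eta, 0 <= r ->
    gamma eta = (RtoC r * gamma xi)%C -> gamma eta = gamma xi.

(* The first return map fixes [(xi, 0)], is (Frechet) differentiable there, and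
   its Jacobian matrix [[a, b], [c, d]] has determinant 1. *)
Definition return_jacobian (hI mu : R) (gamma : R -> C) (D : C -> Prop)
    (xi a b c d : R) : Prop :=
  exists F : R * R -> R * R,
    return_map_near hI mu gamma D xi F /\
    F (xi, 0) = (xi, 0) /\
    differentiable_pt_lim (fun x y => fst (F (x, y))) xi 0 a b /\
    differentiable_pt_lim (fun x y => snd (F (x, y))) xi 0 c d /\
    a * d - b * c = 1.

Definition unstable (hI mu : R) (gamma : R -> C) (D : C -> Prop) (xi : R) : Prop :=
  central_configuration gamma xi /\
  exists a b c d, return_jacobian hI mu gamma D xi a b c d /\ (a + d) ^ 2 - 4 > 0.

Definition stable (hI mu : R) (gamma : R -> C) (D : C -> Prop) (xi : R) : Prop :=
  central_configuration gamma xi /\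
  exists a b c d, return_jacobian hI mu gamma D xi a b c d /\ (a + d) ^ 2 - 4 < 0.

Definition ellipse (b x0 xi : R) : C := (cos xi + x0, b * sin xi).

Definition ellipse_interior (b x0 : R) (z : C) : Prop :=
  (fst z - x0) ^ 2 + (snd z / b) ^ 2 < 1.

(* Main.v *)
Require Import Defs.
From Stdlib Require Import Reals Lra Psatz ClassicalEpsilon.
From Coquelicot Require Import Coquelicot.
Open Scope R_scope.

(** In the Levi-Civita plane [z = w^2] an inner arc is a solution of the linear
    equation [w'' = (hI / 2) w], so that the collision disappears and everything is
    explicit: [first_return_lc_iff] turns a first return into a statement about the
    curve [w(s) = w0 cosh (k s) + w1 sinh (k s) / k] with [k = sqrt (hI / 2)].

    Let the vertex be [xi = 0], at distance [r = 1 + x0] from the mass.  The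
    homothetic arc is the real solution running from [sqrt r] to [- sqrt r] in a
    fictitious time [S0] with [cosh (k S0) = c = 2 (hI + mu / r) r / mu - 1]
    ([homothetic_arc]).  It crosses the ellipse transversally at both ends and is inside in between, so that
    every nearby arc has a first exit, at a time [S] depending continuously on the
    initial conditions ([first_exit_time_continuous], applied in [exit_time]).

    Continuity of [S] is all that the derivative of the return map requires.  Indeed
    [sin xi1] and [sin alpha1] are sums of products in which one factor is the
    imaginary part of [w], or of [w'], at the exit.  These imaginary parts are linear
    in the initial ones, which vanish on the homothetic arc and are differentiable
    there, with coefficients that are continuous functions of [S]; in a product of a
    differentiable function vanishing at a point with a continuous one, only the
    value of the latter enters the derivative ([vanishes_with_slopes]).

    The Jacobian obtained in [return_jacobian_0] has determinant 1 and trace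
    [t = 4 (c + 1) r / b^2 - 4 c - 2], whence
    [t - 2 = 4 (c + 1) (r / b^2 - 1)] and [t + 2 = 4 ((c + 1) r / b^2 - c)].  As
    [1 / (c + 1) = mu / (2 r (hI + mu / r))], the product [t^2 - 4] is a positive
    multiple of the quantity in the statement, with [r] in place of [1 - x0] or
    [1 + x0] ([discriminant_eq]).  At the vertex farther from the mass
    [b^2 < 1 <= r] makes both factors of this quantity negative.  The vertex
    [xi = PI] reduces to [xi = 0] by the half-turn [z -> - z], which changes [x0]
    into [- x0] ([return_jacobian_half_turn]). *)

(** * Calculus on the line and in the plane *)

Lemma is_derive_C_iff (f : R -> C) (t : R) (l : C) :
  is_derive f t l <->
  is_derive (fun s => fst (f s)) t (fst l) /\
  is_derive (fun s => snd (f s)) t (snd l).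
Proof.
  unfold is_derive. split.
  - intros H. split.
    + exact (filterdiff_comp' f fst t (fun y : R => scal y l) fst H
               (filterdiff_linear fst is_linear_fst)).
    + exact (filterdiff_comp' f snd t (fun y : R => scal y l) snd H
               (filterdiff_linear snd is_linear_snd)).
  - intros [H1 H2].
    apply (filterdiff_ext (fun s => (fst (f s), snd (f s)))).
    { intros y. now destruct (f y). }
    apply (filterdiff_comp'_2 _ _ (fun u v : R => (u, v)) t
             (fun y : R => scal y (fst l)) (fun y : R => scal y (snd l))
             (fun u v => (u, v)) H1 H2).
    apply (filterdiff_ext (fun u => u)).
    { intros [u v]. reflexivity. }
    apply (filterdiff_ext_lin _ (fun u => u)).
    + apply filterdiff_id.
    + intros [u v]. reflexivity.
Qed.

Lemma MVT_lt (f df : R -> R) (a b : R) :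
  a < b -> (forall s, a <= s <= b -> is_derive f s (df s)) ->
  exists c, a < c < b /\ f b - f a = df c * (b - a).
Proof.
  intros Hab H.
  destruct (MVT_cor2 f df a b Hab) as [c [Hc Hin]].
  { intros c Hc. apply is_derive_Reals. now apply H. }
  now exists c.
Qed.

Lemma is_derive_zero_const (f : R -> R) :
  (forall s, is_derive f s 0) -> forall a b, f a = f b.
Proof.
  assert (K : forall f, (forall s, is_derive f s 0) -> forall a b, a < b -> f a = f b).
  { clear f; intros f H a b Hab.
    destruct (MVT_lt f (fun _ => 0) a b Hab) as [c [_ Hc]]; [auto | lra]. }
  intros H a b. destruct (Rtotal_order a b) as [L | [-> | L]]; auto.
  symmetry; auto.
Qed.

(** * The linear equation of the Levi-Civita plane *)

Definition hyper (hI a c s : R) : R :=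
  a * cosh (sqrt (hI / 2) * s) + c * (sinh (sqrt (hI / 2) * s) / sqrt (hI / 2)).

Definition hyper' (hI a c s : R) : R :=
  a * (sqrt (hI / 2) * sinh (sqrt (hI / 2) * s)) + c * cosh (sqrt (hI / 2) * s).

Lemma cosh_sinh_sqr (x : R) : cosh x ^ 2 = 1 + sinh x ^ 2.
Proof.
  assert (H : exp x * exp (- x) = 1).
  { rewrite <- exp_plus, Rplus_opp_r. apply exp_0. }
  unfold cosh, sinh. nra.
Qed.

Lemma is_derive_cosh (x : R) : is_derive cosh x (sinh x).
Proof. apply is_derive_Reals, derivable_pt_lim_cosh. Qed.

Lemma is_derive_sinh (x : R) : is_derive sinh x (cosh x).
Proof. apply is_derive_Reals, derivable_pt_lim_sinh. Qed.

Lemma frequency_pos (hI : R) : 0 < hI -> 0 < sqrt (hI / 2).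
Proof. intros H. apply sqrt_lt_R0. lra. Qed.

Lemma frequency_sqr (hI : R) : 0 < hI -> sqrt (hI / 2) ^ 2 = hI / 2.
Proof. intros H. apply pow2_sqrt. lra. Qed.

Lemma is_derive_cosh_scal (k s : R) :
  is_derive (fun s => cosh (k * s)) s (k * sinh (k * s)).
Proof.
  apply (is_derive_comp cosh (fun s => k * s) s (sinh (k * s)) k).
  - apply is_derive_cosh.
  - auto_derive; [auto | ring].
Qed.

Lemma is_derive_sinh_scal (k s : R) :
  is_derive (fun s => sinh (k * s)) s (k * cosh (k * s)).
Proof.
  apply (is_derive_comp sinh (fun s => k * s) s (cosh (k * s)) k).
  - apply is_derive_sinh.
  - auto_derive; [auto | ring].
Qed.

Lemma is_derive_hyper (hI a c s : R) :
  0 < hI -> is_derive (hyper hI a c) s (hyper' hI a c s).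
Proof.
  intros Hh. pose proof (frequency_pos hI Hh) as W.
  apply (is_derive_ext (fun s => a * cosh (sqrt (hI / 2) * s)
           + c / sqrt (hI / 2) * sinh (sqrt (hI / 2) * s))).
  { intros r. unfold hyper. match goal with |- @eq _ ?x ?y => change (@eq R x y) end.
    field. lra. }
  unfold hyper'. evar_last.
  { apply @is_derive_plus.
    - apply is_derive_scal, is_derive_cosh_scal.
    - apply (is_derive_scal _ s (c / sqrt (hI / 2))), is_derive_sinh_scal. }
  unfold plus; simpl. field. lra.
Qed.

Lemma is_derive_hyper' (hI a c s : R) :
  0 < hI -> is_derive (hyper' hI a c) s (hI / 2 * hyper hI a c s).
Proof.
  intros Hh. pose proof (frequency_pos hI Hh) as W.
  rewrite <- (frequency_sqr hI Hh).
  unfold hyper, hyper'.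
  evar_last.
  { apply @is_derive_plus.
    - apply is_derive_scal, is_derive_scal, is_derive_sinh_scal.
    - apply is_derive_scal, is_derive_cosh_scal. }
  unfold plus, scal, mult; simpl. field. lra.
Qed.

Lemma hyper_0 (hI a c : R) : 0 < hI -> hyper hI a c 0 = a.
Proof.
  intros Hh. pose proof (frequency_pos hI Hh) as W.
  unfold hyper. rewrite Rmult_0_r, cosh_0, sinh_0. field. lra.
Qed.

Lemma hyper'_0 (hI a c : R) : hyper' hI a c 0 = c.
Proof. unfold hyper'. rewrite Rmult_0_r, cosh_0, sinh_0. ring. Qed.

Lemma hyper_energy (hI a c s : R) :
  0 < hI ->
  2 * hyper' hI a c s ^ 2 - hI * hyper hI a c s ^ 2 = 2 * c ^ 2 - hI * a ^ 2.
Proof.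
  intros Hh. pose proof (frequency_pos hI Hh) as W.
  pose proof (frequency_sqr hI Hh) as W2.
  unfold hyper, hyper'. set (k := sqrt (hI / 2)) in *.
  clearbody k. assert (Eh : hI = 2 * k ^ 2) by lra. subst hI.
  pose proof (cosh_sinh_sqr (k * s)) as E.
  set (C := cosh (k * s)) in *; set (S := sinh (k * s)) in *.
  transitivity ((2 * c ^ 2 - 2 * k ^ 2 * a ^ 2) * (C ^ 2 - S ^ 2)).
  - field. lra.
  - rewrite E. ring.
Qed.

(** Both combinations below are first integrals of the linear equation; solving
    them for [f] and [f'] gives the solution through the data at [s0]. *)
Lemma hyper_unique (hI : R) (f f' : R -> R) (s0 : R) :
  0 < hI ->
  (forall s, is_derive f s (f' s)) ->
  (forall s, is_derive f' s (hI / 2 * f s)) ->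
  forall s, f (s0 + s) = hyper hI (f s0) (f' s0) s /\
            f' (s0 + s) = hyper' hI (f s0) (f' s0) s.
Proof.
  intros Hh Hf Hf' s.
  pose proof (frequency_pos hI Hh) as W.
  pose proof (frequency_sqr hI Hh) as W2.
  unfold hyper, hyper'.
  set (k := sqrt (hI / 2)) in *.
  assert (D1 : forall s, is_derive (fun s => f (s0 + s)) s (f' (s0 + s))).
  { intros r. evar_last.
    - apply (is_derive_comp f (fun s => s0 + s) r (f' (s0 + r)) 1).
      + apply Hf.
      + auto_derive; [auto | ring].
    - unfold scal; simpl; unfold mult; simpl. ring. }
  assert (D2 : forall s, is_derive (fun s => f' (s0 + s)) s (k ^ 2 * f (s0 + s))).
  { intros r. evar_last.
    - apply (is_derive_comp f' (fun s => s0 + s) r (hI / 2 * f (s0 + r)) 1).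
      + apply Hf'.
      + auto_derive; [auto | ring].
    - change (1 * (hI / 2 * f (s0 + r)) = k ^ 2 * f (s0 + r)). rewrite W2. ring. }
  assert (I1 : k * f (s0 + s) * cosh (k * s) - f' (s0 + s) * sinh (k * s) = k * f s0).
  { transitivity (k * f (s0 + 0) * cosh (k * 0) - f' (s0 + 0) * sinh (k * 0)).
    - apply (is_derive_zero_const
        (fun s => k * f (s0 + s) * cosh (k * s) - f' (s0 + s) * sinh (k * s))).
      intros r. evar_last.
      + apply @is_derive_minus; apply @is_derive_mult.
        * apply is_derive_scal, D1.
        * apply is_derive_cosh_scal.
        * exact Rmult_comm.
        * apply D2.
        * apply is_derive_sinh_scal.
        * exact Rmult_comm.
      + unfold minus, plus, opp, mult; simpl. ring.
    - rewrite Rmult_0_r, Rplus_0_r, cosh_0, sinh_0. ring. }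
  assert (I2 : f' (s0 + s) * cosh (k * s) - k * f (s0 + s) * sinh (k * s) = f' s0).
  { transitivity (f' (s0 + 0) * cosh (k * 0) - k * f (s0 + 0) * sinh (k * 0)).
    - apply (is_derive_zero_const
        (fun s => f' (s0 + s) * cosh (k * s) - k * f (s0 + s) * sinh (k * s))).
      intros r. evar_last.
      + apply @is_derive_minus; apply @is_derive_mult.
        * apply D2.
        * apply is_derive_cosh_scal.
        * exact Rmult_comm.
        * apply is_derive_scal, D1.
        * apply is_derive_sinh_scal.
        * exact Rmult_comm.
      + unfold minus, plus, opp, mult; simpl. ring.
    - rewrite Rmult_0_r, Rplus_0_r, cosh_0, sinh_0. ring. }
  pose proof (cosh_sinh_sqr (k * s)) as E.
  set (C := cosh (k * s)) in *; set (S := sinh (k * s)) in *.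
  set (g := f (s0 + s)) in *; set (g' := f' (s0 + s)) in *.
  rewrite <- I2.
  replace (f s0) with ((k * g * C - g' * S) / k) by (rewrite I1; field; lra).
  split.
  - transitivity (g * (C ^ 2 - S ^ 2)); [rewrite E; ring | field; lra].
  - transitivity (g' * (C ^ 2 - S ^ 2)); [rewrite E; ring | field; lra].
Qed.

(** * Arcs in the Levi-Civita plane and their clock *)

Definition lc_pos (hI : R) (w0 w1 : C) (s : R) : C :=
  (hyper hI (fst w0) (fst w1) s, hyper hI (snd w0) (snd w1) s).

Definition lc_vel (hI : R) (w0 w1 : C) (s : R) : C :=
  (hyper' hI (fst w0) (fst w1) s, hyper' hI (snd w0) (snd w1) s).

(** [|z'|^2 / 2 = V_I z] read upstairs, where it makes sense at [w = 0] too. *)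
Definition lc_energy (hI mu : R) (w0 w1 : C) : Prop :=
  2 * dot w1 w1 = hI * dot w0 w0 + mu.

(** The physical time elapsed since [s = 0]. *)
Definition clock (hI mu : R) (w0 w1 : C) (s : R) : R :=
  (dot (lc_pos hI w0 w1 s) (lc_vel hI w0 w1 s) - dot w0 w1 - mu / 2 * s) / hI.

Lemma Cmod_sqr (z : C) : Cmod z ^ 2 = dot z z.
Proof.
  unfold Cmod, dot. rewrite pow2_sqrt; [ring | nra].
Qed.

Lemma dot_self_pos (z : C) : z <> 0%C -> 0 < dot z z.
Proof.
  intros H. rewrite <- Cmod_sqr. apply pow_lt, Cmod_gt_0, H.
Qed.

Lemma dot_self_nonneg (z : C) : 0 <= dot z z.
Proof. unfold dot. nra. Qed.

Lemma is_derive_lc_pos (hI : R) (w0 w1 : C) (s : R) :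
  0 < hI -> is_derive (lc_pos hI w0 w1) s (lc_vel hI w0 w1 s).
Proof.
  intros Hh. apply is_derive_C_iff. split; apply (is_derive_hyper hI _ _ s Hh).
Qed.

Lemma is_derive_lc_vel (hI : R) (w0 w1 : C) (s : R) :
  0 < hI -> is_derive (lc_vel hI w0 w1) s (RtoC (hI / 2) * lc_pos hI w0 w1 s)%C.
Proof.
  intros Hh. apply is_derive_C_iff. split.
  - replace (fst (RtoC (hI / 2) * lc_pos hI w0 w1 s)%C)
      with (hI / 2 * hyper hI (fst w0) (fst w1) s) by (simpl; ring).
    apply (is_derive_hyper' hI _ _ s Hh).
  - replace (snd (RtoC (hI / 2) * lc_pos hI w0 w1 s)%C)
      with (hI / 2 * hyper hI (snd w0) (snd w1) s) by (simpl; ring).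
    apply (is_derive_hyper' hI _ _ s Hh).
Qed.

Lemma lc_pos_0 (hI : R) (w0 w1 : C) : 0 < hI -> lc_pos hI w0 w1 0 = w0.
Proof.
  intros Hh. unfold lc_pos. rewrite !hyper_0 by assumption. now destruct w0.
Qed.

Lemma lc_vel_0 (hI : R) (w0 w1 : C) : lc_vel hI w0 w1 0 = w1.
Proof. unfold lc_vel. rewrite !hyper'_0. now destruct w1. Qed.

Lemma lc_energy_conserved (hI mu : R) (w0 w1 : C) (s : R) :
  0 < hI -> lc_energy hI mu w0 w1 ->
  lc_energy hI mu (lc_pos hI w0 w1 s) (lc_vel hI w0 w1 s).
Proof.
  intros Hh E. unfold lc_energy, dot in *. simpl.
  pose proof (hyper_energy hI (fst w0) (fst w1) s Hh).
  pose proof (hyper_energy hI (snd w0) (snd w1) s Hh).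
  nra.
Qed.

Lemma is_derive_dot (u v u' v' : R -> C) (s : R) :
  is_derive u s (u' s) -> is_derive v s (v' s) ->
  is_derive (fun s => dot (u s) (v s)) s (dot (u' s) (v s) + dot (u s) (v' s)).
Proof.
  intros Hu Hv.
  apply is_derive_C_iff in Hu. apply is_derive_C_iff in Hv.
  destruct Hu as [Hu1 Hu2]. destruct Hv as [Hv1 Hv2].
  unfold dot. evar_last.
  - apply @is_derive_plus; apply @is_derive_mult; try exact Rmult_comm; eassumption.
  - unfold plus, mult; simpl. ring.
Qed.

Lemma is_derive_lc_norm (hI : R) (w0 w1 : C) (s : R) :
  0 < hI ->
  is_derive (fun s => dot (lc_pos hI w0 w1 s) (lc_pos hI w0 w1 s)) s
    (2 * dot (lc_pos hI w0 w1 s) (lc_vel hI w0 w1 s)).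
Proof.
  intros Hh. evar_last.
  - apply (is_derive_dot _ _ (lc_vel hI w0 w1) (lc_vel hI w0 w1));
      now apply is_derive_lc_pos.
  - unfold dot. ring.
Qed.

Lemma is_derive_lc_radial (hI mu : R) (w0 w1 : C) (s : R) :
  0 < hI -> lc_energy hI mu w0 w1 ->
  is_derive (fun s => dot (lc_pos hI w0 w1 s) (lc_vel hI w0 w1 s)) s
    (hI * dot (lc_pos hI w0 w1 s) (lc_pos hI w0 w1 s) + mu / 2).
Proof.
  intros Hh E. evar_last.
  - apply (is_derive_dot _ _ (lc_vel hI w0 w1)
             (fun s => RtoC (hI / 2) * lc_pos hI w0 w1 s)%C).
    + now apply is_derive_lc_pos.
    + now apply is_derive_lc_vel.
  - pose proof (lc_energy_conserved hI mu w0 w1 s Hh E) as Es.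
    unfold lc_energy, dot in *. simpl in *. lra.
Qed.

(** This is Kepler's equation: along the oscillator [|w|^2] is, up to constants,
    the derivative of [w . w'], so that the fictitious time integrates in closed
    form. *)
Lemma is_derive_clock (hI mu : R) (w0 w1 : C) (s : R) :
  0 < hI -> lc_energy hI mu w0 w1 ->
  is_derive (clock hI mu w0 w1) s
    (dot (lc_pos hI w0 w1 s) (lc_pos hI w0 w1 s)).
Proof.
  intros Hh E.
  apply (is_derive_ext (fun s => / hI *
    (dot (lc_pos hI w0 w1 s) (lc_vel hI w0 w1 s) + - (dot w0 w1 + mu / 2 * s)))).
  { intros r. unfold clock. match goal with |- @eq _ ?x ?y => change (@eq R x y) end.
    field. lra. }
  evar_last.
  - apply is_derive_scal. apply @is_derive_plus.
    + now apply (is_derive_lc_radial hI mu).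
    + instantiate (1 := - (mu / 2)). auto_derive; [auto | ring].
  - unfold plus; simpl. field. lra.
Qed.

Lemma clock_0 (hI mu : R) (w0 w1 : C) : 0 < hI -> clock hI mu w0 w1 0 = 0.
Proof.
  intros Hh. unfold clock. rewrite lc_pos_0, lc_vel_0 by assumption. field. lra.
Qed.

(** The radial velocity [w . w'] vanishes at a collision and is strictly
    increasing, its derivative being at least [mu / 2]. *)
Lemma lc_collision_unique (hI mu : R) (w0 w1 : C) (s1 s2 : R) :
  0 < hI -> 0 < mu -> lc_energy hI mu w0 w1 ->
  dot (lc_pos hI w0 w1 s1) (lc_pos hI w0 w1 s1) = 0 ->
  dot (lc_pos hI w0 w1 s2) (lc_pos hI w0 w1 s2) = 0 -> s1 = s2.
Proof.
  intros Hh Hm E.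
  assert (K : forall s1 s2, s1 < s2 ->
    dot (lc_pos hI w0 w1 s1) (lc_pos hI w0 w1 s1) = 0 ->
    dot (lc_pos hI w0 w1 s2) (lc_pos hI w0 w1 s2) = 0 -> False).
  { intros a b Hab Ha Hb.
    destruct (MVT_lt _ _ a b Hab
                (fun s _ => is_derive_lc_radial hI mu w0 w1 s Hh E)) as [c [_ Hc]].
    assert (Za : dot (lc_pos hI w0 w1 a) (lc_vel hI w0 w1 a) = 0).
    { unfold dot in *. replace (fst (lc_pos hI w0 w1 a)) with 0 by nra.
      replace (snd (lc_pos hI w0 w1 a)) with 0 by nra. ring. }
    assert (Zb : dot (lc_pos hI w0 w1 b) (lc_vel hI w0 w1 b) = 0).
    { unfold dot in *. replace (fst (lc_pos hI w0 w1 b)) with 0 by nra.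
      replace (snd (lc_pos hI w0 w1 b)) with 0 by nra. ring. }
    rewrite Za, Zb in Hc.
    pose proof (dot_self_nonneg (lc_pos hI w0 w1 c)).
    assert (0 < (hI * dot (lc_pos hI w0 w1 c) (lc_pos hI w0 w1 c) + mu / 2) * (b - a)).
    { apply Rmult_lt_0_compat; nra. }
    lra. }
  intros H1 H2. destruct (Rtotal_order s1 s2) as [L | [L | L]]; auto.
  - destruct (K s1 s2 L H1 H2).
  - destruct (K s2 s1 L H2 H1).
Qed.

Lemma clock_increasing (hI mu : R) (w0 w1 : C) (a b : R) :
  0 < hI -> 0 < mu -> lc_energy hI mu w0 w1 -> a < b ->
  clock hI mu w0 w1 a < clock hI mu w0 w1 b.
Proof.
  intros Hh Hm E Hab.
  (* One point in each half of [a, b]: at most one of the two is a collision. *)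
  set (m := (a + b) / 2).
  assert (D : forall s, is_derive (clock hI mu w0 w1) s
            (dot (lc_pos hI w0 w1 s) (lc_pos hI w0 w1 s))).
  { intros s. now apply is_derive_clock. }
  destruct (MVT_lt (clock hI mu w0 w1) _ a m ltac:(unfold m; lra) (fun s _ => D s))
    as [c [Hc Ec]].
  destruct (MVT_lt (clock hI mu w0 w1) _ m b ltac:(unfold m; lra) (fun s _ => D s))
    as [d [Hd Ed]].
  pose proof (dot_self_nonneg (lc_pos hI w0 w1 c)) as Pc.
  pose proof (dot_self_nonneg (lc_pos hI w0 w1 d)) as Pd.
  assert (N : 0 < dot (lc_pos hI w0 w1 c) (lc_pos hI w0 w1 c)
              + dot (lc_pos hI w0 w1 d) (lc_pos hI w0 w1 d)).
  { destruct (Req_dec (dot (lc_pos hI w0 w1 c) (lc_pos hI w0 w1 c)) 0) as [Zc |]; [|lra].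
    destruct (Req_dec (dot (lc_pos hI w0 w1 d) (lc_pos hI w0 w1 d)) 0) as [Zd |]; [|lra].
    assert (c = d) by (eapply (lc_collision_unique hI mu w0 w1); eauto). lra. }
  assert (m - a = (b - a) / 2) by (unfold m; lra).
  assert (b - m = (b - a) / 2) by (unfold m; lra).
  nra.
Qed.

Lemma tends_to_infty_of_derive (f df : R -> R) (m : R) :
  0 < m -> (forall s, is_derive f s (df s)) ->
  (exists a, forall s, a <= s -> m <= df s) ->
  forall M, exists a, forall s, a <= s -> M <= f s.
Proof.
  intros Hm D [a Ha] M.
  exists (a + 1 + Rabs (M - f a) / m). intros s Hs.
  assert (0 <= Rabs (M - f a) / m).
  { apply Rdiv_le_0_compat; [apply Rabs_pos | lra]. }
  destruct (MVT_lt f df a s ltac:(lra) (fun s _ => D s)) as [c [Hc Ec]].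
  pose proof (Ha c ltac:(lra)).
  assert (m * (Rabs (M - f a) / m) <= df c * (s - a)).
  { apply Rmult_le_compat; lra. }
  replace (m * (Rabs (M - f a) / m)) with (Rabs (M - f a)) in H1 by (field; lra).
  pose proof (Rle_abs (M - f a)). lra.
Qed.

(** The three successive derivatives of the clock, [|w|^2], [2 w . w'] and
    [2 hI |w|^2 + mu], become large one after the other, starting from the last,
    which is at least [mu]. *)
Lemma clock_large (hI mu : R) (w0 w1 : C) :
  0 < hI -> 0 < mu -> lc_energy hI mu w0 w1 ->
  forall M, exists a, forall s, a <= s -> M <= clock hI mu w0 w1 s.
Proof.
  intros Hh Hm E.
  apply (tends_to_infty_of_derive _ _ 1 Rlt_0_1
           (fun s => is_derive_clock hI mu w0 w1 s Hh E)).
  refine (tends_to_infty_of_derive _ _ 1 Rlt_0_1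
           (fun s => is_derive_lc_norm hI w0 w1 s Hh) _ 1).
  destruct (tends_to_infty_of_derive _ _ (mu / 2) ltac:(lra)
           (fun s => is_derive_lc_radial hI mu w0 w1 s Hh E)) with (M := 1) as [a Ha].
  - exists 0. intros s _. pose proof (dot_self_nonneg (lc_pos hI w0 w1 s)). nra.
  - exists a. intros s Hs. specialize (Ha s Hs). lra.
Qed.

Lemma clock_opp (hI mu : R) (w0 w1 : C) (s : R) :
  0 < hI -> clock hI mu w0 w1 (- s) = - clock hI mu w0 (- w1)%C s.
Proof.
  intros Hh. pose proof (frequency_pos hI Hh).
  unfold clock, dot, lc_pos, lc_vel, hyper, hyper'. simpl.
  rewrite Ropp_mult_distr_r_reverse.
  replace (cosh (- (sqrt (hI / 2) * s))) with (cosh (sqrt (hI / 2) * s)).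
  replace (sinh (- (sqrt (hI / 2) * s))) with (- sinh (sqrt (hI / 2) * s)).
  - field. split; lra.
  - unfold sinh. rewrite Ropp_involutive. field.
  - unfold cosh. rewrite Ropp_involutive. field.
Qed.

Lemma clock_surjective (hI mu : R) (w0 w1 : C) :
  0 < hI -> 0 < mu -> lc_energy hI mu w0 w1 ->
  forall t, exists s, clock hI mu w0 w1 s = t.
Proof.
  intros Hh Hm E t.
  destruct (clock_large hI mu w0 w1 Hh Hm E t) as [a Ha].
  assert (E' : lc_energy hI mu w0 (- w1)%C).
  { unfold lc_energy, dot in *. simpl. lra. }
  destruct (clock_large hI mu w0 (- w1)%C Hh Hm E' (- t)) as [b Hb].
  specialize (Ha a (Rle_refl a)). specialize (Hb b (Rle_refl b)).
  pose proof (clock_opp hI mu w0 w1 b Hh) as Eb.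
  destruct (IVT_gen (clock hI mu w0 w1) (- b) a t) as [s [_ Hs]].
  - intros s. apply continuity_pt_filterlim.
    apply (ex_derive_continuous (clock hI mu w0 w1)).
    eexists. now apply is_derive_clock.
  - split.
    + apply (Rle_trans _ _ _ (Rmin_l _ _)). lra.
    + apply (Rle_trans _ _ _ Ha), Rmax_r.
  - now exists s.
Qed.

(** * Inner motions through their arcs *)

(** The chord slopes of [f] at [g t] invert to those of [g] at [t]; monotonicity
    of [f] makes its inverse continuous, which turns one limit into the other. *)
Lemma is_derive_inverse (f g : R -> R) (t l : R) :
  (forall a b, a < b -> f a < f b) -> (forall s, f (g s) = s) ->
  is_derive f (g t) l -> l <> 0 -> is_derive g t (/ l).
Proof.
  intros Hf Hfg Hd Hl. apply is_derive_Reals in Hd. apply is_derive_Reals.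
  assert (Hg : forall s, g (f s) = s).
  { intros s. destruct (Rtotal_order (g (f s)) s) as [L | [L | L]]; auto.
    - apply Hf in L. rewrite Hfg in L. lra.
    - apply Hf in L. rewrite Hfg in L. lra. }
  assert (Hmono : forall a b, a < b -> g a < g b).
  { intros a b L. destruct (Rlt_or_le (g a) (g b)) as [|L']; auto.
    destruct L' as [L' | L'].
    - apply Hf in L'. rewrite !Hfg in L'. lra.
    - apply (f_equal f) in L'. rewrite !Hfg in L'. lra. }
  intros eps Heps.
  pose proof (Rabs_pos_lt l Hl) as Pl.
  set (e := Rmin (Rabs l / 2) (eps * Rabs l * Rabs l / 2)).
  assert (He : 0 < e).
  { apply Rmin_glb_lt; [lra |].
    apply Rdiv_lt_0_compat; [|lra]. repeat apply Rmult_lt_0_compat; auto. }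
  destruct (Hd e He) as [d Hdd].
  set (dd := Rmin (f (g t + d) - t) (t - f (g t - d))).
  assert (Hdd0 : 0 < dd).
  { pose proof (cond_pos d).
    pose proof (Hf (g t) (g t + d) ltac:(lra)) as L1.
    pose proof (Hf (g t - d) (g t) ltac:(lra)) as L2. rewrite Hfg in L1, L2.
    apply Rmin_glb_lt; lra. }
  exists (mkposreal dd Hdd0). simpl. intros h Hh Lh.
  set (k := g (t + h) - g t).
  assert (Ek : f (g t + k) = t + h).
  { unfold k. replace (g t + (g (t + h) - g t)) with (g (t + h)) by ring. apply Hfg. }
  assert (Hk : k <> 0).
  { intros Z. rewrite Z, Rplus_0_r, Hfg in Ek. lra. }
  assert (Lk : Rabs k < d).
  { apply Rabs_def2 in Lh. destruct Lh as [Lh1 Lh2].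
    assert (dd <= f (g t + d) - t) by apply Rmin_l.
    assert (dd <= t - f (g t - d)) by apply Rmin_r.
    pose proof (Hmono (t + h) (f (g t + d)) ltac:(lra)) as M1.
    pose proof (Hmono (f (g t - d)) (t + h) ltac:(lra)) as M2.
    rewrite Hg in M1, M2. unfold k. apply Rabs_def1; lra. }
  specialize (Hdd k Hk Lk). rewrite Ek, Hfg in Hdd.
  replace ((t + h - t) / k) with (h / k) in Hdd by (f_equal; ring).
  set (q := h / k) in *.
  assert (Eq : h = q * k) by (unfold q; field; exact Hk).
  assert (E1 : e <= Rabs l / 2) by apply Rmin_l.
  assert (E2 : e <= eps * Rabs l * Rabs l / 2) by apply Rmin_r.
  assert (Pq : Rabs l / 2 < Rabs q).
  { pose proof (Rabs_triang (q) (- (q - l))) as Tr.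
    replace (q + - (q - l)) with l in Tr by ring. rewrite Rabs_Ropp in Tr. lra. }
  assert (Hq : q <> 0).
  { intros Z. rewrite Z, Rabs_R0 in Pq. lra. }
  change (Rabs (k / h - / l) < eps).
  replace (k / h - / l) with (- (q - l) / (q * l)).
  2:{ rewrite Eq. field. auto. }
  rewrite Rabs_div, Rabs_Ropp, Rabs_mult by (apply Rmult_integral_contrapositive; auto).
  apply Rlt_div_l; [apply Rlt_gt, Rmult_lt_0_compat; lra |].
  apply (Rlt_le_trans _ _ _ Hdd). apply (Rle_trans _ _ _ E2).
  replace (eps * Rabs l * Rabs l / 2) with (eps * (Rabs l / 2 * Rabs l)) by field.
  apply Rmult_le_compat_l; [lra |]. apply Rmult_le_compat_r; lra.
Qed.

(** Velocity [dz / dt = 2 w w' / |w|^2] of the physical motion [z = w^2]. *)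
Definition lc_speed (w w1 : C) : C :=
  (2 * (fst w * fst w1 - snd w * snd w1) / dot w w,
   2 * (fst w * snd w1 + snd w * fst w1) / dot w w).

Lemma is_derive_Csqr (w w' : R -> C) (s : R) :
  is_derive w s (w' s) ->
  is_derive (fun s => (w s * w s)%C) s
    (2 * (fst (w s) * fst (w' s) - snd (w s) * snd (w' s)),
     2 * (fst (w s) * snd (w' s) + snd (w s) * fst (w' s))).
Proof.
  intros H. apply is_derive_C_iff in H. destruct H as [H1 H2].
  apply is_derive_C_iff. split; simpl.
  - evar_last.
    + apply @is_derive_minus; apply @is_derive_mult; try exact Rmult_comm; eassumption.
    + unfold minus, plus, opp, mult; simpl. ring.
  - evar_last.
    + apply @is_derive_plus; apply @is_derive_mult; try exact Rmult_comm; eassumption.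
    + unfold minus, plus, opp, mult; simpl. ring.
Qed.

Lemma Cmod_Csqr (w : C) : Cmod (w * w)%C = dot w w.
Proof. rewrite Cmod_mult, <- Cmod_sqr. ring. Qed.

Lemma Csqr_neq_0 (w : C) : (w * w)%C <> 0%C -> dot w w <> 0.
Proof.
  intros H E. apply H. apply Cmod_eq_0. now rewrite Cmod_Csqr.
Qed.

Lemma grad_V_I (hI mu : R) (z : C) :
  z <> 0%C ->
  grad (V_I hI mu) z = (- mu * fst z / Cmod z ^ 3, - mu * snd z / Cmod z ^ 3).
Proof.
  intros Hz. pose proof (dot_self_pos z Hz) as P. unfold dot in P.
  assert (P' : 0 < fst z ^ 2 + snd z ^ 2) by lra.
  pose proof (sqrt_lt_R0 _ P') as Pr.
  pose proof (pow2_sqrt _ (Rlt_le _ _ P')) as Er.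
  unfold grad, V_I, Cmod. simpl fst. simpl snd. f_equal; apply is_derive_unique.
  - auto_derive.
    + replace (fst z * (fst z * 1) + snd z * (snd z * 1))
        with (fst z ^ 2 + snd z ^ 2) by ring.
      repeat split; auto; lra.
    + replace (fst z * (fst z * 1) + snd z * (snd z * 1))
        with (fst z ^ 2 + snd z ^ 2) by ring.
      field. lra.
  - auto_derive.
    + replace (fst z * (fst z * 1) + snd z * (snd z * 1))
        with (fst z ^ 2 + snd z ^ 2) by ring.
      repeat split; auto; lra.
    + replace (fst z * (fst z * 1) + snd z * (snd z * 1))
        with (fst z ^ 2 + snd z ^ 2) by ring.
      field. lra.
Qed.

(** Newton's equation in the fictitious time: [d/ds (dz/dt) = |w|^2 grad V]. *)
Lemma is_derive_lc_speed (hI mu : R) (w0 w1 : C) (s : R) :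
  0 < hI -> lc_energy hI mu w0 w1 ->
  let w := lc_pos hI w0 w1 in
  let w' := lc_vel hI w0 w1 in
  dot (w s) (w s) <> 0 ->
  is_derive (fun s => lc_speed (w s) (w' s)) s
    (RtoC (dot (w s) (w s)) * grad (V_I hI mu) (w s * w s))%C.
Proof.
  intros Hh E w w' N.
  assert (Hz : (w s * w s)%C <> 0%C).
  { intros Z. apply N. rewrite <- Cmod_Csqr, Z. apply Cmod_0. }
  rewrite grad_V_I by exact Hz. rewrite Cmod_Csqr.
  pose proof (lc_energy_conserved hI mu w0 w1 s Hh E) as Es.
  pose proof (is_derive_lc_pos hI w0 w1 s Hh) as D1.
  pose proof (is_derive_lc_vel hI w0 w1 s Hh) as D2.
  pose proof (is_derive_lc_norm hI w0 w1 s Hh) as D3.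
  apply is_derive_C_iff in D1. apply is_derive_C_iff in D2.
  destruct D1 as [Dx Dy]. destruct D2 as [Dx' Dy'].
  fold w in Dx, Dy, Dx', Dy', D3, Es. fold w' in Dx, Dy, Dx', Dy', D3, Es.
  assert (Em : mu = 2 * dot (w' s) (w' s) - hI * dot (w s) (w s)).
  { unfold lc_energy in Es. lra. }
  apply is_derive_C_iff. split.
  - evar_last.
    + unfold lc_speed. simpl. apply (is_derive_div _ _ s); [| exact D3 | exact N].
      apply is_derive_scal. apply @is_derive_minus; apply @is_derive_mult;
        try exact Rmult_comm; eassumption.
    + rewrite Em. unfold dot in *. unfold minus, plus, opp, mult; simpl.
      field. exact N.
  - evar_last.
    + unfold lc_speed. simpl. apply (is_derive_div _ _ s); [| exact D3 | exact N].
      apply is_derive_scal. apply @is_derive_plus; apply @is_derive_mult;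
        try exact Rmult_comm; eassumption.
    + rewrite Em. unfold dot in *. unfold minus, plus, opp, mult; simpl.
      field. exact N.
Qed.

Lemma lc_speed_energy (hI mu : R) (w w1 : C) :
  lc_energy hI mu w w1 -> dot w w <> 0 ->
  dot (lc_speed w w1) (lc_speed w w1) = 2 * V_I hI mu (w * w)%C.
Proof.
  intros E N. unfold V_I. rewrite Cmod_Csqr.
  transitivity (4 * dot w1 w1 / dot w w).
  - unfold lc_speed, dot in *; simpl. field. exact N.
  - unfold lc_energy in E. replace (4 * dot w1 w1) with (2 * (hI * dot w w + mu)) by lra.
    field. exact N.
Qed.

Lemma is_derive_C_comp (f : R -> C) (g : R -> R) (t : R) (l : C) (k : R) :
  is_derive f (g t) l -> is_derive g t k ->
  is_derive (fun t => f (g t)) t (RtoC k * l)%C.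
Proof.
  intros Hf Hg. evar_last.
  - apply (is_derive_comp f g t l k Hf Hg).
  - destruct l as [a b]. unfold scal; simpl. unfold prod_scal, scal; simpl.
    unfold mult; simpl. apply injective_projections; simpl; ring.
Qed.

(** Away from the collision the clock can be inverted differentiably, and [w^2] at
    the inverse clock solves Newton's equation; through the collision only
    [levi_civita] speaks, and it does so in terms of [w]. *)
Lemma inner_motion_exists (hI mu : R) (w0 w1 : C) :
  0 < hI -> 0 < mu -> lc_energy hI mu w0 w1 ->
  exists z v, inner_motion hI mu z v /\
    forall s, z (clock hI mu w0 w1 s)
                = (lc_pos hI w0 w1 s * lc_pos hI w0 w1 s)%C /\
              v (clock hI mu w0 w1 s)
                = lc_speed (lc_pos hI w0 w1 s) (lc_vel hI w0 w1 s).
Proof.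
  intros Hh Hm E.
  pose proof (clock_surjective hI mu w0 w1 Hh Hm E) as Surj.
  destruct (choice _ Surj) as [tau Htau].
  pose proof (fun a b => clock_increasing hI mu w0 w1 a b Hh Hm E) as Inc.
  assert (Inv : forall s, tau (clock hI mu w0 w1 s) = s).
  { intros s.
    destruct (Rtotal_order (tau (clock hI mu w0 w1 s)) s) as [L | [L | L]]; auto;
      apply Inc in L; rewrite Htau in L; lra. }
  set (w := lc_pos hI w0 w1). set (w' := lc_vel hI w0 w1).
  exists (fun t => (w (tau t) * w (tau t))%C),
    (fun t => lc_speed (w (tau t)) (w' (tau t))).
  split; [split |].
  - intros t Hz.
    pose proof (Csqr_neq_0 _ Hz) as N.
    assert (Dt : is_derive tau t (/ dot (w (tau t)) (w (tau t)))).
    { apply (is_derive_inverse (clock hI mu w0 w1)); auto.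
      now apply is_derive_clock. }
    split; [| split].
    + evar_last.
      * apply (is_derive_C_comp (fun s => (w s * w s)%C) tau t _ _
                 (is_derive_Csqr w w' (tau t) (is_derive_lc_pos hI w0 w1 _ Hh)) Dt).
      * unfold lc_speed. apply injective_projections; simpl; field; exact N.
    + evar_last.
      * apply (is_derive_C_comp (fun s => lc_speed (w s) (w' s)) tau t _ _
                 (is_derive_lc_speed hI mu w0 w1 (tau t) Hh E N) Dt).
      * fold w. apply injective_projections; simpl; field; exact N.
    + rewrite Cmod_sqr, (lc_speed_energy hI mu); auto.
      * lra.
      * now apply lc_energy_conserved.
  - exists w, w', (clock hI mu w0 w1). split; [|exact Surj].
    intros s. split; [| split; [| split]].
    + now apply is_derive_lc_pos.
    + now apply is_derive_lc_vel.
    + rewrite Cmod_sqr. now apply is_derive_clock.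
    + now rewrite Inv.
  - intros s. rewrite Inv. auto.
Qed.

Lemma Csqr_eq_cases (u v : C) : (u * u = v * v)%C -> u = v \/ u = (- v)%C.
Proof.
  intros H. assert (E : ((u - v) * (u + v) = 0)%C).
  { transitivity (u * u - v * v)%C; [ring | rewrite H; ring]. }
  destruct (Ceq_dec u v) as [|N]; auto. right.
  assert (N' : (u - v)%C <> 0%C).
  { intros Z. apply N. transitivity (u - v + v)%C; [ring | rewrite Z; ring]. }
  assert (Z : (u + v)%C = 0%C).
  { transitivity (/ (u - v) * ((u - v) * (u + v)))%C; [field; exact N' | rewrite E; ring]. }
  transitivity (u + v - v)%C; [ring | rewrite Z; ring].
Qed.

Lemma is_derive_C_unique (f : R -> C) (t : R) (l1 l2 : C) :
  is_derive f t l1 -> is_derive f t l2 -> l1 = l2.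
Proof.
  intros H1 H2. apply is_derive_C_iff in H1. apply is_derive_C_iff in H2.
  destruct H1 as [A1 B1]. destruct H2 as [A2 B2].
  apply injective_projections.
  - now rewrite <- (is_derive_unique _ _ _ A1), <- (is_derive_unique _ _ _ A2).
  - now rewrite <- (is_derive_unique _ _ _ B1), <- (is_derive_unique _ _ _ B2).
Qed.

(** Off collisions the relation [z (tm s) = w(s)^2] can be differentiated, and
    Newton's equation identifies the derivative of [z] with the velocity. *)
Lemma lc_speed_of_derive (z v w w' : R -> C) (tm : R -> R) (s : R) :
  (forall s, z (tm s) = (w s * w s)%C) ->
  is_derive w s (w' s) -> is_derive tm s (dot (w s) (w s)) ->
  dot (w s) (w s) <> 0 -> is_derive z (tm s) (v (tm s)) ->
  v (tm s) = lc_speed (w s) (w' s).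
Proof.
  intros Hz Hw Ht N Dz.
  pose proof (is_derive_C_comp z tm s _ _ Dz Ht) as D1.
  apply (is_derive_ext _ (fun s => (w s * w s)%C)) in D1; [|exact Hz].
  pose proof (is_derive_C_unique _ _ _ _ D1 (is_derive_Csqr w w' s Hw)) as Eq.
  pose proof (f_equal fst Eq) as E1. pose proof (f_equal snd Eq) as E2.
  simpl in E1, E2.
  unfold lc_speed. apply injective_projections; simpl.
  - rewrite <- E1. field. exact N.
  - rewrite <- E2. field. exact N.
Qed.

Lemma lc_speed_inj (w w1 w2 : C) :
  dot w w <> 0 -> lc_speed w w1 = lc_speed w w2 -> w1 = w2.
Proof.
  intros N Eq.
  pose proof (f_equal fst Eq) as E1. pose proof (f_equal snd Eq) as E2.
  unfold lc_speed in E1, E2. simpl in E1, E2.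
  apply (f_equal (fun r => r * dot w w / 2)) in E1.
  apply (f_equal (fun r => r * dot w w / 2)) in E2.
  field_simplify in E1; [|exact N|exact N]. field_simplify in E2; [|exact N|exact N].
  unfold dot in N.
  assert (N2 : 0 < fst w ^ 2 + snd w ^ 2) by nra.
  apply injective_projections.
  - apply (Rmult_eq_reg_l (fst w ^ 2 + snd w ^ 2)); [|lra].
    transitivity (fst w * (fst w * fst w1 - snd w * snd w1)
                  + snd w * (fst w * snd w1 + snd w * fst w1)); [ring|].
    replace (fst w * fst w1 - snd w * snd w1) with (fst w * fst w2 - snd w * snd w2) by lra.
    replace (fst w * snd w1 + snd w * fst w1) with (fst w * snd w2 + snd w * fst w2) by lra.
    ring.
  - apply (Rmult_eq_reg_l (fst w ^ 2 + snd w ^ 2)); [|lra].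
    transitivity (fst w * (fst w * snd w1 + snd w * fst w1)
                  - snd w * (fst w * fst w1 - snd w * snd w1)); [ring|].
    replace (fst w * fst w1 - snd w * snd w1) with (fst w * fst w2 - snd w * snd w2) by lra.
    replace (fst w * snd w1 + snd w * fst w1) with (fst w * snd w2 + snd w * fst w2) by lra.
    ring.
Qed.

Definition lc_lift (hI : R) (z : R -> C) (w w' : R -> C) (tm : R -> R) : Prop :=
  forall s, is_derive w s (w' s) /\ is_derive w' s (RtoC (hI / 2) * w s)%C /\
            is_derive tm s (Cmod (w s) ^ 2) /\ z (tm s) = (w s * w s)%C.

Lemma is_derive_Copp (f : R -> C) (t : R) (l : C) :
  is_derive f t l -> is_derive (fun s => (- f s)%C) t (- l)%C.
Proof.
  intros H. apply is_derive_C_iff in H. destruct H as [A B].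
  apply is_derive_C_iff. split; simpl.
  - apply (is_derive_opp (fun s => fst (f s)) t (fst l) A).
  - apply (is_derive_opp (fun s => snd (f s)) t (snd l) B).
Qed.

Lemma lc_lift_opp (hI : R) (z w w' : R -> C) (tm : R -> R) :
  lc_lift hI z w w' tm -> lc_lift hI z (fun s => - w s)%C (fun s => - w' s)%C tm.
Proof.
  intros H s. destruct (H s) as [H1 [H2 [H3 H4]]]. split; [|split; [|split]].
  - now apply is_derive_Copp.
  - replace (RtoC (hI / 2) * - w s)%C with (- (RtoC (hI / 2) * w s))%C by ring.
    now apply is_derive_Copp.
  - now rewrite Cmod_opp.
  - rewrite H4. ring.
Qed.

Lemma lc_lift_unique (hI mu : R) (z w w' : R -> C) (tm : R -> R) (w0 w1 : C) (s0 : R) :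
  0 < hI -> lc_energy hI mu w0 w1 ->
  lc_lift hI z w w' tm -> tm s0 = 0 -> w s0 = w0 -> w' s0 = w1 ->
  forall s, z (clock hI mu w0 w1 s)
              = (lc_pos hI w0 w1 s * lc_pos hI w0 w1 s)%C.
Proof.
  intros Hh E L Ht Hw Hw' s.
  assert (D : forall r, is_derive (fun s => fst (w s)) r (fst (w' r)) /\
                        is_derive (fun s => snd (w s)) r (snd (w' r)) /\
                        is_derive (fun s => fst (w' s)) r (hI / 2 * fst (w r)) /\
                        is_derive (fun s => snd (w' s)) r (hI / 2 * snd (w r))).
  { intros r. destruct (L r) as [D1 [D2 _]].
    apply is_derive_C_iff in D1. apply is_derive_C_iff in D2.
    destruct D1 as [D1 D1']. destruct D2 as [D2 D2']. simpl in D2, D2'.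
    replace (hI / 2 * fst (w r) - 0 * snd (w r)) with (hI / 2 * fst (w r)) in D2 by ring.
    replace (hI / 2 * snd (w r) + 0 * fst (w r)) with (hI / 2 * snd (w r)) in D2' by ring.
    auto. }
  assert (Hp : forall s, w (s0 + s) = lc_pos hI w0 w1 s).
  { intros r. apply injective_projections; simpl; rewrite <- Hw, <- Hw'.
    - apply (hyper_unique hI (fun s => fst (w s)) (fun s => fst (w' s)) s0 Hh);
        intros x; apply (D x).
    - apply (hyper_unique hI (fun s => snd (w s)) (fun s => snd (w' s)) s0 Hh);
        intros x; apply (D x). }
  assert (Hc : tm (s0 + s) = clock hI mu w0 w1 s).
  { assert (Z : tm (s0 + s) - clock hI mu w0 w1 s = tm (s0 + 0) - clock hI mu w0 w1 0).
    { apply (is_derive_zero_const (fun s => tm (s0 + s) - clock hI mu w0 w1 s)).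
      intros r. evar_last.
      - apply @is_derive_minus.
        + apply (is_derive_comp tm (fun s => s0 + s) r (Cmod (w (s0 + r)) ^ 2) 1).
          * apply L.
          * auto_derive; [auto | ring].
        + now apply is_derive_clock.
      - rewrite Cmod_sqr, Hp. unfold scal, minus, plus, opp; simpl. unfold mult; simpl. ring. }
    rewrite Rplus_0_r, Ht, clock_0 in Z by exact Hh. lra. }
  rewrite <- Hc, <- Hp. apply L.
Qed.

(** A lift of [z] is determined by its value and derivative at one time, and these
    are determined up to a common sign by [z 0 = w0^2] and [v 0].  Changing the sign
    of the lift changes nothing downstairs. *)
Lemma inner_motion_unique (hI mu : R) (z v : R -> C) (w0 w1 : C) :
  0 < hI -> lc_energy hI mu w0 w1 -> dot w0 w0 <> 0 ->
  inner_motion hI mu z v -> z 0 = (w0 * w0)%C -> v 0 = lc_speed w0 w1 ->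
  forall s, z (clock hI mu w0 w1 s) = (lc_pos hI w0 w1 s * lc_pos hI w0 w1 s)%C /\
    (dot (lc_pos hI w0 w1 s) (lc_pos hI w0 w1 s) <> 0 ->
     v (clock hI mu w0 w1 s) = lc_speed (lc_pos hI w0 w1 s) (lc_vel hI w0 w1 s)).
Proof.
  intros Hh E N0 [Newton [w [w' [tm [L Surj]]]]] Hz Hv.
  assert (Hpos : forall s, z (clock hI mu w0 w1 s)
                   = (lc_pos hI w0 w1 s * lc_pos hI w0 w1 s)%C).
  { destruct (Surj 0) as [s0 Hs0].
    assert (K : forall w w', lc_lift hI z w w' tm -> w s0 = w0 ->
              forall s, z (clock hI mu w0 w1 s)
                = (lc_pos hI w0 w1 s * lc_pos hI w0 w1 s)%C).
    { clear w w' L. intros w w' L Hw.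
      apply (lc_lift_unique hI mu z w w' tm w0 w1 s0); auto.
      apply (lc_speed_inj w0); [exact N0|]. rewrite <- Hv, <- Hs0, <- Hw.
      symmetry. destruct (L s0) as [D1 [_ [D3 _]]].
      apply (lc_speed_of_derive z v w w' tm s0); auto.
      - intros s. apply L.
      - now rewrite <- Cmod_sqr.
      - now rewrite Hw.
      - apply Newton. rewrite Hs0, Hz. intros Z. apply N0.
        now rewrite <- Cmod_Csqr, Z, Cmod_0. }
    assert (Sq : (w s0 * w s0 = w0 * w0)%C).
    { rewrite <- Hz, <- Hs0. symmetry. apply L. }
    destruct (Csqr_eq_cases _ _ Sq) as [Hw | Hw].
    - now apply (K w w').
    - apply (K (fun s => - w s)%C (fun s => - w' s)%C).
      + now apply lc_lift_opp.
      + rewrite Hw. ring. }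
  intros s. split; [apply Hpos |]. intros N.
  apply (lc_speed_of_derive z v (lc_pos hI w0 w1) (lc_vel hI w0 w1)
           (clock hI mu w0 w1) s Hpos); auto.
  - now apply is_derive_lc_pos.
  - now apply is_derive_clock.
  - apply Newton. rewrite Hpos. intros Z. apply N.
    now rewrite <- Cmod_Csqr, Z, Cmod_0.
Qed.

(** In the fictitious time the first return is a statement about one explicit
    curve, without reference to a particular solution of Newton's equation. *)
Lemma first_return_lc_iff (hI mu : R) (gamma : R -> C) (D : C -> Prop)
    (p q : R * R) (w0 w1 : C) :
  0 < hI -> 0 < mu -> lc_energy hI mu w0 w1 -> dot w0 w0 <> 0 ->
  gamma (fst p) = (w0 * w0)%C ->
  launch hI mu gamma (fst p) (snd p) = lc_speed w0 w1 ->
  gamma (fst q) <> 0%C ->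
  let w := lc_pos hI w0 w1 in
  let w' := lc_vel hI w0 w1 in
  first_return hI mu gamma D p q <->
  - (PI / 2) < snd p < PI / 2 /\ - (PI / 2) < snd q < PI / 2 /\
  exists S, 0 < S /\ (forall s, 0 < s < S -> D (w s * w s)%C) /\
    (w S * w S)%C = gamma (fst q) /\
    reflect gamma (fst q) (lc_speed (w S) (w' S))
      = launch hI mu gamma (fst q) (snd q).
Proof.
  intros Hh Hm E N0 Hp Hl Hq w w'.
  pose proof (fun a b => clock_increasing hI mu w0 w1 a b Hh Hm E) as Inc.
  pose proof (clock_0 hI mu w0 w1 Hh) as C0.
  assert (Refl : forall a b, clock hI mu w0 w1 a < clock hI mu w0 w1 b -> a < b).
  { intros a b L. destruct (Rtotal_order a b) as [|[-> | L']]; auto; [lra|].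
    apply Inc in L'. lra. }
  split.
  - intros [Ap [Aq [z [v [T [M [HT [H0 [V0 [HD [HzT HvT]]]]]]]]]]].
    split; [exact Ap | split; [exact Aq |]].
    rewrite Hp in H0. rewrite Hl in V0.
    pose proof (inner_motion_unique hI mu z v w0 w1 Hh E N0 M H0 V0) as U.
    destruct (clock_surjective hI mu w0 w1 Hh Hm E T) as [S HS].
    destruct (U S) as [U1 U2]. rewrite HS, HzT in U1. rewrite HS in U2.
    exists S. split; [|split; [|split]].
    + apply Refl. lra.
    + intros s [Hs1 Hs2]. unfold w. rewrite <- (proj1 (U s)). apply HD.
      apply Inc in Hs1. apply Inc in Hs2. lra.
    + now rewrite U1.
    + unfold w, w'. rewrite <- U2; [exact HvT |].
      apply Csqr_neq_0. now rewrite <- U1.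
  - intros [Ap [Aq [S [HS [HD [Hz Hv]]]]]].
    split; [exact Ap | split; [exact Aq |]].
    destruct (inner_motion_exists hI mu w0 w1 Hh Hm E) as [z [v [M U]]].
    exists z, v, (clock hI mu w0 w1 S).
    pose proof (U 0) as [U0 V0].
    rewrite C0, lc_pos_0 in U0, V0 by exact Hh. rewrite lc_vel_0 in V0.
    split; [exact M | split; [|split; [|split; [|split; [|split]]]]].
    + apply Inc in HS. lra.
    + now rewrite U0, Hp.
    + now rewrite V0, Hl.
    + intros t [Ht1 Ht2]. destruct (clock_surjective hI mu w0 w1 Hh Hm E t) as [s Hs].
      rewrite <- Hs, (proj1 (U s)). apply HD. split; apply Refl; lra.
    + now rewrite (proj1 (U S)).
    + now rewrite (proj2 (U S)).
Qed.

(** * First exit of a family of curves *)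

Lemma locally_box {U : UniformSpace} (s0 : R) (p0 : U) (P : R -> U -> Prop) :
  locally ((s0, p0) : R * U) (fun q => P (fst q) (snd q)) ->
  exists d : posreal, forall s p, Rabs (s - s0) < d -> ball p0 d p -> P s p.
Proof.
  intros [d Hd]. exists d. intros s p Hs Hp. apply (Hd (s, p)). now split.
Qed.

(** Lebesgue's number for the cover of [a, b] by the intervals on which the property
    is uniform gives one neighbourhood of [p0] for all times. *)
Lemma tube {U : UniformSpace} (p0 : U) (a b : R) (P : R -> U -> Prop) :
  (forall s, a <= s <= b -> locally ((s, p0) : R * U) (fun q => P (fst q) (snd q))) ->
  locally p0 (fun p => forall s, a <= s <= b -> P s p).
Proof.
  intros H.
  assert (Hd : forall s, exists d : posreal, a <= s <= b ->
            forall r p, Rabs (r - s) < d -> ball p0 d p -> P r p).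
  { intros s. destruct (classic (a <= s <= b)) as [I | I].
    - destruct (locally_box s p0 P (H s I)) as [d Hd]. now exists d.
    - exists (mkposreal 1 Rlt_0_1). intros J. contradiction. }
  destruct (choice _ Hd) as [delta Hdelta].
  destruct (compactness_value_1d a b delta) as [d Hcover].
  exists d. intros p Hp s Hs. apply NNPP. intros N.
  apply (Hcover s Hs). intros [t [It [Ht Hdt]]]. apply N.
  apply (Hdelta t It); auto.
  now apply (ball_le p0 d).
Qed.

Lemma continuous_locally_neg {U : UniformSpace} (f : U -> R) (x : U) :
  continuous f x -> f x < 0 -> locally x (fun y => f y < 0).
Proof. intros C L. exact (C _ (open_lt 0 (f x) L)). Qed.

Lemma continuous_locally_pos {U : UniformSpace} (f : U -> R) (x : U) :
  continuous f x -> 0 < f x -> locally x (fun y => 0 < f y).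
Proof. intros C L. exact (C _ (open_gt 0 (f x) L)). Qed.

(** [G < 0] is the domain.  The curve of the parameter [p0] enters and leaves it
    transversally; near the two ends monotonicity in [s] persists for nearby
    parameters, and in between compactness keeps the nearby curves inside. *)
Lemma first_exit_near {U : UniformSpace} (p0 : U) (G H : R -> U -> R) (S0 eps : R) :
  (forall s p, is_derive (fun s => G s p) s (H s p)) ->
  (forall s, continuous (fun q : R * U => G (fst q) (snd q)) (s, p0)) ->
  (forall s, continuous (fun q : R * U => H (fst q) (snd q)) (s, p0)) ->
  locally p0 (fun p => G 0 p = 0) ->
  0 < S0 -> G S0 p0 = 0 -> H 0 p0 < 0 -> 0 < H S0 p0 ->
  (forall s, 0 < s < S0 -> G s p0 < 0) -> 0 < eps ->
  locally p0 (fun p => exists S, 0 < S /\ Rabs (S - S0) < eps /\ G S p = 0 /\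
                       forall s, 0 < s < S -> G s p < 0).
Proof.
  intros D CG CH G0 HS0 GS0 H0 HS Hin Heps.
  destruct (locally_box 0 p0 (fun s p => H s p < 0)
    (continuous_locally_neg _ _ (CH 0) H0)) as [d1 Hd1].
  destruct (locally_box S0 p0 (fun s p => 0 < H s p)
    (continuous_locally_pos _ _ (CH S0) HS)) as [d2 Hd2].
  set (eta := Rmin (Rmin (d1 / 2) (d2 / 2)) (Rmin (eps / 2) (S0 / 3))).
  pose proof (cond_pos d1). pose proof (cond_pos d2).
  assert (E : (eta <= d1 / 2 /\ eta <= d2 / 2) /\ eta <= eps / 2 /\ eta <= S0 / 3).
  { pose proof (Rmin_l (d1 / 2) (d2 / 2)). pose proof (Rmin_r (d1 / 2) (d2 / 2)).
    pose proof (Rmin_l (eps / 2) (S0 / 3)). pose proof (Rmin_r (eps / 2) (S0 / 3)).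
    pose proof (Rmin_l (Rmin (d1 / 2) (d2 / 2)) (Rmin (eps / 2) (S0 / 3))).
    pose proof (Rmin_r (Rmin (d1 / 2) (d2 / 2)) (Rmin (eps / 2) (S0 / 3))).
    unfold eta. lra. }
  destruct E as [[E1 E2] [E3 E4]].
  assert (E0 : 0 < eta) by (unfold eta; apply Rmin_glb_lt; apply Rmin_glb_lt; lra).
  clearbody eta.
  assert (Gend : 0 < G (S0 + eta) p0).
  { destruct (MVT_lt (fun s => G s p0) (fun s => H s p0) S0 (S0 + eta) ltac:(lra)
      (fun s _ => D s p0)) as [c [Hc Ec]].
    assert (0 < H c p0).
    { apply Hd2; [apply Rabs_def1; lra | apply ball_center]. }
    nra. }
  assert (Lend : locally p0 (fun p => 0 < G (S0 + eta) p)).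
  { destruct (locally_box _ p0 (fun s p => 0 < G s p)
      (continuous_locally_pos _ _ (CG (S0 + eta)) Gend)) as [d Hd].
    exists d. intros p Hp. apply Hd; auto. rewrite Rminus_diag, Rabs_R0. apply cond_pos. }
  assert (Lmid : locally p0 (fun p => forall s, eta <= s <= S0 - eta -> G s p < 0)).
  { apply (tube p0 eta (S0 - eta) (fun s p => G s p < 0)).
    intros s Hs. apply (continuous_locally_neg (fun q : R * U => G (fst q) (snd q))).
    - apply CG.
    - apply Hin. simpl. lra. }
  assert (L1 : locally p0 (ball p0 d1)) by (now exists d1).
  assert (L2 : locally p0 (ball p0 d2)) by (now exists d2).
  generalize (filter_and _ _ G0 (filter_and _ _ Lend (filter_and _ _ Lmid
                (filter_and _ _ L1 L2)))).
  apply filter_imp. intros p [P0 [Pend [Pmid [B1 B2]]]].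
  assert (Pstart : G (S0 - eta) p < 0) by (apply Pmid; lra).
  destruct (IVT_gen (fun s => G s p) (S0 - eta) (S0 + eta) 0) as [S [IS ES]].
  - intros s. apply continuity_pt_filterlim.
    apply (ex_derive_continuous (fun s => G s p)). eexists. apply D.
  - rewrite Rmin_left, Rmax_right by lra. lra.
  - rewrite Rmin_left, Rmax_right in IS by lra.
    exists S. split; [lra | split; [|split; [exact ES |]]].
    + apply Rabs_def1; lra.
    + intros s Hs. destruct (Rle_lt_dec eta s) as [L | L].
      * destruct (Rle_lt_dec s (S0 - eta)) as [L' | L'].
        -- apply Pmid. lra.
        -- destruct (MVT_lt (fun s => G s p) (fun s => H s p) s S ltac:(lra)
             (fun s _ => D s p)) as [c [Hc Ec]].
           assert (0 < H c p) by (apply Hd2; [apply Rabs_def1; lra | exact B2]).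
           simpl in Ec. nra.
      * destruct (MVT_lt (fun s => G s p) (fun s => H s p) 0 s ltac:(lra)
             (fun s _ => D s p)) as [c [Hc Ec]].
        assert (H c p < 0) by (apply Hd1; [apply Rabs_def1; lra | exact B1]).
        simpl in Ec. nra.
Qed.

(** * Continuity of real expressions *)

Lemma cont_plus {U : UniformSpace} (f g : U -> R) (x : U) :
  continuous f x -> continuous g x -> continuous (fun y => f y + g y) x.
Proof. intros; now apply @continuous_plus. Qed.

Lemma cont_minus {U : UniformSpace} (f g : U -> R) (x : U) :
  continuous f x -> continuous g x -> continuous (fun y => f y - g y) x.
Proof. intros; now apply @continuous_minus. Qed.

Lemma cont_opp {U : UniformSpace} (f : U -> R) (x : U) :
  continuous f x -> continuous (fun y => - f y) x.
Proof. intros; now apply @continuous_opp. Qed.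

Lemma cont_mult {U : UniformSpace} (f g : U -> R) (x : U) :
  continuous f x -> continuous g x -> continuous (fun y => f y * g y) x.
Proof. intros; now apply @continuous_mult. Qed.

Lemma cont_real_comp {U : UniformSpace} (h : R -> R) (f : U -> R) (x : U) :
  ex_derive h (f x) -> continuous f x -> continuous (fun y => h (f y)) x.
Proof.
  intros D C. apply continuous_comp; [exact C|].
  now apply (ex_derive_continuous h).
Qed.

Lemma cont_inv {U : UniformSpace} (f : U -> R) (x : U) :
  f x <> 0 -> continuous f x -> continuous (fun y => / f y) x.
Proof.
  intros N C. apply (cont_real_comp Rinv); [|exact C]. now auto_derive.
Qed.

Lemma cont_div {U : UniformSpace} (f g : U -> R) (x : U) :
  g x <> 0 -> continuous f x -> continuous g x -> continuous (fun y => f y / g y) x.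
Proof. intros N C1 C2. apply cont_mult; [exact C1 | now apply cont_inv]. Qed.

Lemma cont_pow {U : UniformSpace} (f : U -> R) (n : nat) (x : U) :
  continuous f x -> continuous (fun y => f y ^ n) x.
Proof. intros C. apply (cont_real_comp (fun r => r ^ n)); [now auto_derive | exact C]. Qed.

Lemma cont_sqrt {U : UniformSpace} (f : U -> R) (x : U) :
  continuous f x -> continuous (fun y => sqrt (f y)) x.
Proof. intros C. apply continuous_comp; [exact C | apply continuous_sqrt]. Qed.

Lemma cont_sin {U : UniformSpace} (f : U -> R) (x : U) :
  continuous f x -> continuous (fun y => sin (f y)) x.
Proof. intros C. apply (cont_real_comp sin); [now auto_derive | exact C]. Qed.

Lemma cont_cos {U : UniformSpace} (f : U -> R) (x : U) :
  continuous f x -> continuous (fun y => cos (f y)) x.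
Proof. intros C. apply (cont_real_comp cos); [now auto_derive | exact C]. Qed.

Lemma cont_sinh {U : UniformSpace} (f : U -> R) (x : U) :
  continuous f x -> continuous (fun y => sinh (f y)) x.
Proof.
  intros C. apply (cont_real_comp sinh); [eexists; apply is_derive_sinh | exact C].
Qed.

Lemma cont_cosh {U : UniformSpace} (f : U -> R) (x : U) :
  continuous f x -> continuous (fun y => cosh (f y)) x.
Proof.
  intros C. apply (cont_real_comp cosh); [eexists; apply is_derive_cosh | exact C].
Qed.

(** * Derivatives at a zero through factorisation *)

(** Caratheodory's form of differentiability at a zero of [f], with differential
    [(a, b)].  It is preserved by multiplication with functions that are merely
    continuous, such as the exit time. *)
Definition vanishes_with_slopes (f : R * R -> R) (a b : R) : Prop :=
  exists A B : R * R -> R,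
    continuous A (0, 0) /\ continuous B (0, 0) /\ A (0, 0) = a /\ B (0, 0) = b /\
    forall p, f p = A p * fst p + B p * snd p.

Lemma slopes_fst : vanishes_with_slopes fst 1 0.
Proof.
  exists (fun _ => 1), (fun _ => 0). repeat split; try apply continuous_const.
  intros p. ring.
Qed.

Lemma slopes_snd : vanishes_with_slopes snd 0 1.
Proof.
  exists (fun _ => 0), (fun _ => 1). repeat split; try apply continuous_const.
  intros p. ring.
Qed.

Lemma slopes_plus (f g : R * R -> R) (a b c d : R) :
  vanishes_with_slopes f a b -> vanishes_with_slopes g c d ->
  vanishes_with_slopes (fun p => f p + g p) (a + c) (b + d).
Proof.
  intros [A [B [CA [CB [EA [EB E]]]]]] [A' [B' [CA' [CB' [EA' [EB' E']]]]]].
  exists (fun p => A p + A' p), (fun p => B p + B' p).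
  split; [now apply cont_plus | split; [now apply cont_plus |]].
  rewrite EA, EB, EA', EB'. repeat split. intros p. rewrite E, E'. ring.
Qed.

Lemma slopes_mult (g f : R * R -> R) (a b : R) :
  continuous g (0, 0) -> vanishes_with_slopes f a b ->
  vanishes_with_slopes (fun p => g p * f p) (g (0, 0) * a) (g (0, 0) * b).
Proof.
  intros Cg [A [B [CA [CB [EA [EB E]]]]]].
  exists (fun p => g p * A p), (fun p => g p * B p).
  split; [now apply cont_mult | split; [now apply cont_mult |]].
  rewrite EA, EB. repeat split. intros p. rewrite E. ring.
Qed.

Lemma slopes_ext (f g : R * R -> R) (a b c d : R) :
  vanishes_with_slopes f a b -> (forall p, f p = g p) -> a = c -> b = d ->
  vanishes_with_slopes g c d.
Proof.
  intros [A [B [CA [CB [EA [EB E]]]]]] H <- <-. exists A, B.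
  repeat split; auto. intros p. now rewrite <- H.
Qed.

Lemma slopes_continuous (f : R * R -> R) (a b : R) :
  vanishes_with_slopes f a b -> continuous f (0, 0).
Proof.
  intros [A [B [CA [CB [_ [_ E]]]]]].
  apply (continuous_ext (fun p => A p * fst p + B p * snd p)).
  - intros p. now rewrite E.
  - apply cont_plus; apply cont_mult; auto using @continuous_fst, @continuous_snd.
Qed.

Lemma slopes_0 (f : R * R -> R) (a b : R) : vanishes_with_slopes f a b -> f (0, 0) = 0.
Proof. intros [A [B [_ [_ [_ [_ E]]]]]]. rewrite E. simpl. ring. Qed.

(** The difference quotient of [h] at 0, completed by [h' 0], is continuous. *)
Lemma slopes_comp (h : R -> R) (l : R) (f : R * R -> R) (a b : R) :
  is_derive h 0 l -> h 0 = 0 -> vanishes_with_slopes f a b ->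
  vanishes_with_slopes (fun p => h (f p)) (l * a) (l * b).
Proof.
  intros D H0 S.
  set (k := fun u => if Req_EM_T u 0 then l else h u / u).
  assert (K0 : k 0 = l).
  { unfold k. destruct (Req_EM_T 0 0); [reflexivity | congruence]. }
  assert (Kc : continuous k 0).
  { intros P [eps HP]. rewrite K0 in HP.
    apply is_derive_Reals in D. destruct (D eps (cond_pos eps)) as [d Hd].
    exists d. intros u Hu. apply HP. unfold k. destruct (Req_EM_T u 0) as [Z | Z].
    - apply ball_center.
    - specialize (Hd u Z). rewrite Rplus_0_l, H0, Rminus_0_r in Hd. apply Hd.
      change (Rabs (u - 0) < d) in Hu. now rewrite Rminus_0_r in Hu. }
  pose proof (slopes_0 _ _ _ S) as F0. pose proof (slopes_continuous _ _ _ S) as Cf.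
  assert (Ckf : continuous (fun p => k (f p)) (0, 0)).
  { apply continuous_comp; [exact Cf |]. now rewrite F0. }
  apply (slopes_ext _ _ _ _ _ _ (slopes_mult _ _ _ _ Ckf S)).
  - intros p. unfold k. destruct (Req_EM_T (f p) 0) as [Z | Z].
    + rewrite Z, H0. ring.
    + field. exact Z.
  - now rewrite F0, K0.
  - now rewrite F0, K0.
Qed.

Lemma slopes_differentiable (f : R * R -> R) (a b : R) :
  vanishes_with_slopes f a b -> differentiable_pt_lim (fun x y => f (x, y)) 0 0 a b.
Proof.
  intros S eps. pose proof (slopes_0 _ _ _ S) as F0.
  destruct S as [A [B [CA [CB [EA [EB E]]]]]].
  assert (He : 0 < eps / 2) by (pose proof (cond_pos eps); lra).
  assert (LA : locally ((0, 0) : R * R) (fun p => Rabs (A p - a) < eps / 2)).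
  { apply (CA (fun r => Rabs (r - a) < eps / 2)). rewrite EA.
    now exists (mkposreal _ He). }
  assert (LB : locally ((0, 0) : R * R) (fun p => Rabs (B p - b) < eps / 2)).
  { apply (CB (fun r => Rabs (r - b) < eps / 2)). rewrite EB.
    now exists (mkposreal _ He). }
  destruct (filter_and _ _ LA LB) as [d Hd].
  exists d. intros u v Hu Hv.
  destruct (Hd (u, v)) as [HA HB]; [now split |].
  rewrite F0, E. simpl.
  replace (A (u, v) * u + B (u, v) * v - 0 - (a * (u - 0) + b * (v - 0)))
    with ((A (u, v) - a) * u + (B (u, v) - b) * v) by ring.
  rewrite !Rminus_0_r.
  apply (Rle_trans _ _ _ (Rabs_triang _ _)). rewrite !Rabs_mult.
  pose proof (Rmax_l (Rabs u) (Rabs v)). pose proof (Rmax_r (Rabs u) (Rabs v)).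
  pose proof (Rabs_pos u). pose proof (Rabs_pos v).
  pose proof (Rabs_pos (A (u, v) - a)). pose proof (Rabs_pos (B (u, v) - b)).
  assert (Rabs (A (u, v) - a) * Rabs u <= eps / 2 * Rmax (Rabs u) (Rabs v)).
  { apply Rmult_le_compat; lra. }
  assert (Rabs (B (u, v) - b) * Rabs v <= eps / 2 * Rmax (Rabs u) (Rabs v)).
  { apply Rmult_le_compat; lra. }
  lra.
Qed.

(** * Initial data of an arc *)

(** The square root with positive real part; away from the negative half-line it
    is a continuous lift of a boundary point to the Levi-Civita plane. *)
Definition csqrt (z : C) : C :=
  let x := sqrt ((Cmod z + fst z) / 2) in (x, snd z / (2 * x)).

(** [w' = v conj(w) / 2], solved from [v = 2 w w' / |w|^2]. *)
Definition lc_launch (w v : C) : C :=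
  ((fst v * fst w + snd v * snd w) / 2, (snd v * fst w - fst v * snd w) / 2).

Lemma csqrt_sqr (z : C) : 0 < Cmod z + fst z -> (csqrt z * csqrt z)%C = z.
Proof.
  intros H.
  pose proof (Cmod_sqr z) as Ez. unfold dot in Ez.
  assert (Px : 0 < (Cmod z + fst z) / 2) by lra.
  pose proof (sqrt_lt_R0 _ Px) as Ps. pose proof (pow2_sqrt _ (Rlt_le _ _ Px)) as Es.
  unfold csqrt. set (x := sqrt ((Cmod z + fst z) / 2)) in *. clearbody x.
  apply injective_projections; simpl.
  - apply (Rmult_eq_reg_r (4 * x ^ 2)); [|nra].
    transitivity (4 * (x ^ 2) ^ 2 - snd z ^ 2); [field; lra |].
    rewrite Es. nra.
  - field. lra.
Qed.

Lemma lc_speed_launch (w v : C) : dot w w <> 0 -> lc_speed w (lc_launch w v) = v.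
Proof.
  intros N. unfold lc_speed, lc_launch. unfold dot in *.
  apply injective_projections; simpl; field; exact N.
Qed.

Lemma lc_launch_energy (hI mu : R) (w v : C) :
  dot w w <> 0 -> dot v v = 2 * V_I hI mu (w * w)%C ->
  lc_energy hI mu w (lc_launch w v).
Proof.
  intros N E. unfold V_I in E. rewrite Cmod_Csqr in E. unfold lc_energy.
  transitivity (dot v v * dot w w / 2).
  - unfold dot, lc_launch; simpl. field.
  - rewrite E. field. exact N.
Qed.

(** * Reflection at a boundary point *)

Lemma inward_normal_unit (gamma : R -> C) (xi : R) :
  tangent gamma xi <> 0%C ->
  dot (inward_normal gamma xi) (inward_normal gamma xi) = 1.
Proof.
  intros H. rewrite <- Cmod_sqr. unfold inward_normal.
  pose proof (proj1 (Cmod_gt_0 _) H) as P.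
  rewrite Cmod_div.
  - rewrite Cmod_mult, Cmod_R, (Rabs_pos_eq _ (Cmod_ge_0 _)).
    replace (Cmod Ci) with 1.
    + field. lra.
    + unfold Cmod, Ci; simpl. replace (0 * (0 * 1) + 1 * (1 * 1)) with 1 by ring.
      now rewrite sqrt_1.
  - intros Z. apply RtoC_inj in Z. lra.
Qed.

Lemma launch_coordinates (hI mu : R) (gamma : R -> C) (xi alpha : R) :
  let n := inward_normal gamma xi in
  let r := sqrt (2 * V_I hI mu (gamma xi)) in
  launch hI mu gamma xi alpha
    = (r * (cos alpha * fst n - sin alpha * snd n),
       r * (cos alpha * snd n + sin alpha * fst n)).
Proof.
  intros n r. unfold launch. fold n. fold r.
  apply injective_projections; simpl; ring.
Qed.

Lemma launch_norm (hI mu : R) (gamma : R -> C) (xi alpha : R) :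
  tangent gamma xi <> 0%C -> 0 < V_I hI mu (gamma xi) ->
  dot (launch hI mu gamma xi alpha) (launch hI mu gamma xi alpha)
    = 2 * V_I hI mu (gamma xi).
Proof.
  intros Ht HV. pose proof (inward_normal_unit gamma xi Ht) as U.
  rewrite launch_coordinates. cbv zeta. set (n := inward_normal gamma xi) in *.
  pose proof (pow2_sqrt (2 * V_I hI mu (gamma xi)) ltac:(lra)) as Er.
  set (r := sqrt (2 * V_I hI mu (gamma xi))) in *.
  pose proof (sin2_cos2 alpha) as SC. unfold Rsqr in SC.
  rewrite <- Er. clearbody r n. unfold dot in *. simpl.
  transitivity (r ^ 2 * ((sin alpha * sin alpha + cos alpha * cos alpha)
                 * (fst n * fst n + snd n * snd n))); [ring |].
  rewrite SC, U. ring.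
Qed.

(** With [t = i n] the reflected velocity is [- (v.n) n + (v.t) t].  As [v.n < 0], it
    makes with [n] an angle in [(- PI / 2, PI / 2)], the sine of which is
    [v.t / |v|]. *)
Lemma reflect_eq_launch_iff (hI mu : R) (gamma : R -> C) (xi alpha : R) (v : C) :
  tangent gamma xi <> 0%C -> 0 < V_I hI mu (gamma xi) ->
  dot v v = 2 * V_I hI mu (gamma xi) -> dot v (inward_normal gamma xi) < 0 ->
  (- (PI / 2) < alpha < PI / 2 /\
   reflect gamma xi v = launch hI mu gamma xi alpha) <->
  alpha = asin (dot v (Ci * inward_normal gamma xi)%C
                / sqrt (2 * V_I hI mu (gamma xi))).
Proof.
  intros Ht HV Ev Hd. pose proof (inward_normal_unit gamma xi Ht) as U.
  rewrite launch_coordinates. cbv zeta. unfold reflect.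
  set (n := inward_normal gamma xi) in *.
  pose proof (pow2_sqrt (2 * V_I hI mu (gamma xi)) ltac:(lra)) as Er.
  assert (Pr : 0 < sqrt (2 * V_I hI mu (gamma xi))) by (apply sqrt_lt_R0; lra).
  rewrite <- Er in Ev.
  set (r := sqrt (2 * V_I hI mu (gamma xi))) in *. clearbody r n.
  set (d := dot v n) in *. set (t := dot v (Ci * n)%C).
  assert (Et : t = fst n * snd v - snd n * fst v) by (unfold t, dot; simpl; ring).
  assert (Pyth : d ^ 2 + t ^ 2 = r ^ 2).
  { rewrite <- Ev, Et. unfold d. unfold dot in *.
    transitivity ((fst v * fst v + snd v * snd v) * (fst n * fst n + snd n * snd n));
      [ring | rewrite U; ring]. }
  split.
  - intros [Ha Eq].
    pose proof (f_equal fst Eq) as E1. pose proof (f_equal snd Eq) as E2.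
    simpl in E1, E2.
    rewrite <- (asin_sin alpha) by lra. f_equal.
    apply (Rmult_eq_reg_r r); [|lra].
    replace (t / r * r) with t by (field; lra).
    unfold dot in U.
    transitivity (- snd n * (r * (cos alpha * fst n - sin alpha * snd n))
                  + fst n * (r * (cos alpha * snd n + sin alpha * fst n))).
    + transitivity (r * sin alpha * (fst n * fst n + snd n * snd n)); [rewrite U|]; ring.
    + rewrite <- E1, <- E2, Et. ring.
  - intros ->.
    assert (Ht2 : (t / r) ^ 2 < 1).
    { replace ((t / r) ^ 2) with (t ^ 2 / r ^ 2) by (field; lra).
      apply Rlt_div_l; [apply Rlt_gt; nra | nra]. }
    assert (Ht1 : -1 < t / r < 1) by (split; nra).
    split; [now apply asin_bound_lt |].
    rewrite cos_asin, sin_asin by lra.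
    replace (sqrt (1 - (t / r)²)) with (- d / r).
    + unfold dot in U.
      apply injective_projections; simpl.
      * replace (r * (- d / r * fst n - t / r * snd n)) with (- d * fst n - t * snd n)
          by (field; lra).
        transitivity (fst v * (fst n * fst n + snd n * snd n) - 2 * d * fst n);
          [rewrite U; ring | rewrite Et; unfold d, dot; ring].
      * replace (r * (- d / r * snd n + t / r * fst n)) with (- d * snd n + t * fst n)
          by (field; lra).
        transitivity (snd v * (fst n * fst n + snd n * snd n) - 2 * d * snd n);
          [rewrite U; ring | rewrite Et; unfold d, dot; ring].
    + symmetry. apply sqrt_lem_1.
      * unfold Rsqr. nra.
      * apply Rdiv_le_0_compat; lra.
      * unfold Rsqr. replace (- d / r * (- d / r)) with (d ^ 2 / r ^ 2) by (field; lra).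
        replace (d ^ 2) with (r ^ 2 - t ^ 2) by lra. field. lra.
Qed.

(** * The ellipse *)

Lemma tangent_ellipse (b x0 xi : R) :
  tangent (ellipse b x0) xi = (- sin xi, b * cos xi).
Proof.
  unfold tangent, ellipse; simpl.
  f_equal; apply is_derive_unique; auto_derive; auto; ring.
Qed.

Lemma sin2_cos2_weighted_pos (b xi : R) : 0 < b -> 0 < sin xi ^ 2 + (b * cos xi) ^ 2.
Proof.
  intros Hb. pose proof (sin2_cos2 xi) as SC. unfold Rsqr in SC.
  destruct (Req_dec (sin xi) 0) as [Z | Z].
  - rewrite Z in *. assert (0 < b * b) by nra.
    replace (0 ^ 2 + (b * cos xi) ^ 2) with (b * b * (cos xi * cos xi)) by ring. nra.
  - assert (0 < sin xi ^ 2) by nra. pose proof (pow2_ge_0 (b * cos xi)). lra.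
Qed.

Lemma tangent_ellipse_neq_0 (b x0 xi : R) :
  0 < b -> tangent (ellipse b x0) xi <> 0%C.
Proof.
  intros Hb Z. rewrite tangent_ellipse in Z.
  pose proof (f_equal fst Z) as Z1. pose proof (f_equal snd Z) as Z2. simpl in Z1, Z2.
  pose proof (sin2_cos2_weighted_pos b xi Hb). rewrite Z2 in H. nra.
Qed.

Lemma inward_normal_ellipse (b x0 xi : R) :
  0 < b ->
  inward_normal (ellipse b x0) xi
    = (- (b * cos xi) / sqrt (sin xi ^ 2 + (b * cos xi) ^ 2),
       - sin xi / sqrt (sin xi ^ 2 + (b * cos xi) ^ 2)).
Proof.
  intros Hb. unfold inward_normal. rewrite tangent_ellipse.
  unfold Cmod. simpl fst. simpl snd.
  replace ((- sin xi) ^ 2 + (b * cos xi) ^ 2) with (sin xi ^ 2 + (b * cos xi) ^ 2) by ring.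
  pose proof (sqrt_lt_R0 _ (sin2_cos2_weighted_pos b xi Hb)) as P.
  set (r := sqrt (sin xi ^ 2 + (b * cos xi) ^ 2)) in *. clearbody r.
  apply injective_projections; simpl; field; lra.
Qed.

Lemma ellipse_neq_0 (b x0 xi : R) : 0 < b -> -1 < x0 < 1 -> ellipse b x0 xi <> 0%C.
Proof.
  intros Hb Hx Z. pose proof (f_equal fst Z) as Z1. pose proof (f_equal snd Z) as Z2.
  simpl in Z1, Z2. pose proof (sin2_cos2 xi) as SC. unfold Rsqr in SC.
  assert (sin xi = 0) by (apply (Rmult_eq_reg_l b); lra).
  nra.
Qed.

Lemma V_I_pos (hI mu : R) (z : C) : 0 < hI -> 0 < mu -> z <> 0%C -> 0 < V_I hI mu z.
Proof.
  intros Hh Hm Hz. unfold V_I. pose proof (proj1 (Cmod_gt_0 z) Hz).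
  assert (0 < mu / Cmod z) by (apply Rdiv_lt_0_compat; lra). lra.
Qed.

Definition ellipse_eq (b x0 : R) (z : C) : R := (fst z - x0) ^ 2 + (snd z / b) ^ 2 - 1.

Lemma ellipse_eq_ellipse (b x0 xi : R) : 0 < b -> ellipse_eq b x0 (ellipse b x0 xi) = 0.
Proof.
  intros Hb. unfold ellipse_eq, ellipse; simpl.
  pose proof (sin2_cos2 xi) as SC. unfold Rsqr in SC.
  replace (b * sin xi / b) with (sin xi) by (field; lra). lra.
Qed.

(** Only the right half of the ellipse is met, where [asin] inverts [sin]. *)
Lemma ellipse_right_half_iff (b x0 xi : R) (z : C) :
  0 < b -> ellipse_eq b x0 z = 0 -> 0 < fst z - x0 ->
  (z = ellipse b x0 xi /\ Rabs xi < PI) <-> xi = asin (snd z / b).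
Proof.
  intros Hb Ez Hz. unfold ellipse_eq in Ez. split.
  - intros [-> Hxi]. simpl in Hz |- *.
    replace (b * sin xi / b) with (sin xi) by (field; lra).
    assert (Hc : 0 < cos xi) by lra.
    apply Rabs_def2 in Hxi. destruct Hxi as [Hxi1 Hxi2].
    rewrite asin_sin; [reflexivity |]. split.
    + apply Rnot_lt_le. intros L.
      pose proof (cos_le_0 (- xi) ltac:(lra) ltac:(lra)) as N. rewrite cos_neg in N. lra.
    + apply Rnot_lt_le. intros L.
      pose proof (cos_le_0 xi ltac:(lra) ltac:(lra)). lra.
  - intros ->. pose proof PI_RGT_0.
    assert (Hs : -1 <= snd z / b <= 1) by (split; nra).
    pose proof (asin_bound (snd z / b)). split.
    + apply injective_projections; simpl.
      * rewrite cos_asin by exact Hs.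
        replace (1 - (snd z / b)²) with ((fst z - x0)²) by (unfold Rsqr; lra).
        rewrite sqrt_Rsqr by lra. ring.
      * rewrite sin_asin by exact Hs. field. lra.
    + apply Rabs_def1; lra.
Qed.

(** * The homothetic arc *)

Definition boundary_speed (hI mu r : R) : R := sqrt (2 * (hI + mu / r)).

Lemma boundary_speed_pos (hI mu r : R) :
  0 < hI -> 0 < mu -> 0 < r -> 0 < boundary_speed hI mu r.
Proof.
  intros Hh Hm Hr. apply sqrt_lt_R0.
  assert (0 < mu / r) by (apply Rdiv_lt_0_compat; lra). lra.
Qed.

Lemma boundary_speed_sqr (hI mu r : R) :
  0 < hI -> 0 < mu -> 0 < r -> boundary_speed hI mu r ^ 2 = 2 * (hI + mu / r).
Proof.
  intros Hh Hm Hr. apply pow2_sqrt.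
  assert (0 < mu / r) by (apply Rdiv_lt_0_compat; lra). lra.
Qed.

(** The radial fall from [sqrt r] runs through the collision to [- sqrt r].  The
    duration [S0] is known through the hyperbolic functions of it that enter the
    linearisation. *)
Lemma homothetic_arc (hI mu r : R) :
  0 < hI -> 0 < mu -> 0 < r ->
  let v := boundary_speed hI mu r in
  let k := sqrt (hI / 2) in
  let x := hyper hI (sqrt r) (- (v * sqrt r / 2)) in
  exists S0, 0 < S0 /\
    cosh (k * S0) = 2 * (hI + mu / r) * r / mu - 1 /\
    sinh (k * S0) / k = 2 * v * r / mu /\
    x S0 = - sqrt r /\ hyper' hI (sqrt r) (- (v * sqrt r / 2)) S0 = - (v * sqrt r / 2) /\
    forall s, 0 < s < S0 -> x s ^ 2 < r.
Proof.
  intros Hh Hm Hr v k x.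
  assert (Pv : 0 < v) by now apply boundary_speed_pos.
  assert (Ev : v ^ 2 = 2 * (hI + mu / r)) by now apply boundary_speed_sqr.
  assert (Pk : 0 < k) by now apply frequency_pos.
  assert (Ek : k ^ 2 = hI / 2) by now apply frequency_sqr.
  assert (Pr : 0 < sqrt r) by now apply sqrt_lt_R0.
  assert (Er : sqrt r ^ 2 = r) by (apply pow2_sqrt; lra).
  assert (Pmr : 0 < mu / r) by (apply Rdiv_lt_0_compat; lra).
  set (S0 := arcsinh (k * (2 * v * r / mu)) / k).
  assert (Esh : sinh (k * S0) = k * (2 * v * r / mu)).
  { unfold S0. replace (k * (arcsinh (k * (2 * v * r / mu)) / k))
      with (arcsinh (k * (2 * v * r / mu))) by (field; lra).
    apply sinh_arcsinh. }
  assert (HS0 : 0 < S0).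
  { apply Rdiv_lt_0_compat; [|exact Pk]. rewrite <- arcsinh_0. apply arcsinh_lt.
    apply Rmult_lt_0_compat; [exact Pk |]. apply Rdiv_lt_0_compat; [|lra].
    repeat apply Rmult_lt_0_compat; lra. }
  assert (Pc : forall u, 0 < cosh u).
  { intros u. unfold cosh. pose proof (exp_pos u). pose proof (exp_pos (- u)). lra. }
  assert (Ech : cosh (k * S0) = 2 * (hI + mu / r) * r / mu - 1).
  { apply Rsqr_inj.
    - apply Rlt_le, Pc.
    - replace (2 * (hI + mu / r) * r / mu - 1) with (2 * hI * r / mu + 1) by (field; lra).
      assert (0 <= 2 * hI * r / mu); [|lra].
      apply Rdiv_le_0_compat; [|lra]. apply Rlt_le.
      repeat apply Rmult_lt_0_compat; lra.
    - unfold Rsqr. transitivity (cosh (k * S0) ^ 2); [ring |].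
      rewrite cosh_sinh_sqr, Esh.
      transitivity (1 + k ^ 2 * (4 * v ^ 2 * r ^ 2 / mu ^ 2)); [field; lra |].
      rewrite Ek, Ev. field. lra. }
  assert (Esh' : sinh (k * S0) / k = 2 * v * r / mu) by (rewrite Esh; field; lra).
  assert (Ex : x S0 = - sqrt r).
  { unfold x, hyper. fold k. rewrite Ech, Esh'.
    transitivity (sqrt r * (2 * (hI + mu / r) * r / mu - 1 - v ^ 2 * r / mu));
      [field; lra |]. rewrite Ev. field. lra. }
  exists S0. split; [exact HS0 | split; [exact Ech | split; [exact Esh' |]]].
  split; [exact Ex | split].
  - unfold hyper'. fold k. rewrite Ech, Esh.
    transitivity (v * sqrt r * (k ^ 2 * 2 * r / mu - (2 * (hI + mu / r) * r / mu - 1) / 2));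
      [field; lra |]. rewrite Ek. field. lra.
  -
    (* Downhill all the way: [k < v / 2] because [mu > 0], and [sinh < cosh]. *)
    assert (Hkv : k < v / 2) by nra.
    assert (Dx : forall s, hyper' hI (sqrt r) (- (v * sqrt r / 2)) s < 0).
    { intros s. unfold hyper'. fold k.
      assert (sinh (k * s) < cosh (k * s)).
      { unfold sinh, cosh. pose proof (exp_pos (- (k * s))). lra. }
      pose proof (Pc (k * s)).
      replace (sqrt r * (k * sinh (k * s)) + - (v * sqrt r / 2) * cosh (k * s))
        with (- (sqrt r * (v / 2 * cosh (k * s) - k * sinh (k * s)))) by field.
      assert (0 < v / 2 * cosh (k * s) - k * sinh (k * s)) by nra.
      assert (0 < sqrt r * (v / 2 * cosh (k * s) - k * sinh (k * s)))
        by now apply Rmult_lt_0_compat.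
      lra. }
    intros s Hs.
    assert (X0 : x 0 = sqrt r) by now apply hyper_0.
    destruct (MVT_lt x _ 0 s ltac:(lra) (fun s _ => is_derive_hyper hI _ _ s Hh))
      as [c [_ Ec]].
    destruct (MVT_lt x _ s S0 ltac:(lra) (fun s _ => is_derive_hyper hI _ _ s Hh))
      as [d [_ Ed]].
    pose proof (Dx c). pose proof (Dx d).
    assert (x s < sqrt r) by nra. assert (- sqrt r < x s) by nra.
    nra.
Qed.

(** * Arcs near the homothetic one *)

Definition arc_start (b x0 : R) (p : R * R) : C := csqrt (ellipse b x0 (fst p)).

Definition arc_start' (hI mu b x0 : R) (p : R * R) : C :=
  lc_launch (arc_start b x0 p) (launch hI mu (ellipse b x0) (fst p) (snd p)).

Definition arc_pos (hI mu b x0 s : R) (p : R * R) : C :=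
  lc_pos hI (arc_start b x0 p) (arc_start' hI mu b x0 p) s.

Definition arc_vel (hI mu b x0 s : R) (p : R * R) : C :=
  lc_vel hI (arc_start b x0 p) (arc_start' hI mu b x0 p) s.

Definition exit_fun (hI mu b x0 s : R) (p : R * R) : R :=
  ellipse_eq b x0 (arc_pos hI mu b x0 s p * arc_pos hI mu b x0 s p)%C.

Definition exit_fun' (hI mu b x0 s : R) (p : R * R) : R :=
  let w := arc_pos hI mu b x0 s p in
  let w' := arc_vel hI mu b x0 s p in
  4 * (fst (w * w)%C - x0) * (fst w * fst w' - snd w * snd w')
  + 4 * (snd (w * w)%C / b ^ 2) * (fst w * snd w' + snd w * fst w').

Lemma is_derive_exit_fun (hI mu b x0 s : R) (p : R * R) :
  0 < hI -> 0 < b ->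
  is_derive (fun s => exit_fun hI mu b x0 s p) s (exit_fun' hI mu b x0 s p).
Proof.
  intros Hh Hb.
  pose proof (is_derive_Csqr _ _ s (is_derive_lc_pos hI (arc_start b x0 p)
                (arc_start' hI mu b x0 p) s Hh)) as D.
  apply is_derive_C_iff in D. destruct D as [D1 D2].
  unfold exit_fun, exit_fun', arc_pos, arc_vel, ellipse_eq.
  set (w := lc_pos hI (arc_start b x0 p) (arc_start' hI mu b x0 p)) in *.
  set (w' := lc_vel hI (arc_start b x0 p) (arc_start' hI mu b x0 p)) in *.
  cbv zeta.
  evar_last.
  - apply @is_derive_minus; [|apply is_derive_const].
    apply @is_derive_plus.
    + apply (is_derive_comp (fun r => (r - x0) ^ 2) (fun s => fst (w s * w s)%C)); [|exact D1].
      auto_derive; auto.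
    + apply (is_derive_comp (fun r => (r / b) ^ 2) (fun s => snd (w s * w s)%C)); [|exact D2].
      auto_derive; auto.
  - unfold minus, plus, opp, scal, zero; simpl. unfold mult; simpl. field. lra.
Qed.

Lemma cont_hyper {U : UniformSpace} (hI : R) (a c s : U -> R) (x : U) :
  continuous a x -> continuous c x -> continuous s x ->
  continuous (fun y => hyper hI (a y) (c y) (s y)) x.
Proof.
  intros Ca Cc Cs. unfold hyper.
  apply cont_plus; apply cont_mult; auto.
  - apply cont_cosh, cont_mult; auto using @continuous_const.
  - apply (cont_mult _ (fun _ => / sqrt (hI / 2))); auto using @continuous_const.
    apply cont_sinh, cont_mult; auto using @continuous_const.
Qed.

Lemma cont_hyper' {U : UniformSpace} (hI : R) (a c s : U -> R) (x : U) :
  continuous a x -> continuous c x -> continuous s x ->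
  continuous (fun y => hyper' hI (a y) (c y) (s y)) x.
Proof.
  intros Ca Cc Cs. unfold hyper'.
  apply cont_plus; apply cont_mult; auto.
  - apply cont_mult; auto using @continuous_const.
    apply cont_sinh, cont_mult; auto using @continuous_const.
  - apply cont_cosh, cont_mult; auto using @continuous_const.
Qed.

Lemma ellipse_0 (b x0 : R) : ellipse b x0 0 = (1 + x0, 0).
Proof. unfold ellipse. rewrite cos_0, sin_0. f_equal; ring. Qed.

Lemma Cmod_pos_real (r : R) : 0 < r -> Cmod (r, 0) = r.
Proof.
  intros Hr. unfold Cmod. simpl.
  replace (r * (r * 1) + 0 * (0 * 1)) with (Rsqr r) by (unfold Rsqr; ring).
  apply sqrt_Rsqr. lra.
Qed.

Lemma cont_Cmod_ellipse {U : UniformSpace} (b x0 : R) (xi : U -> R) (x : U) :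
  continuous xi x -> continuous (fun y => Cmod (ellipse b x0 (xi y))) x.
Proof.
  intros C. unfold Cmod, ellipse. simpl fst. simpl snd.
  apply cont_sqrt, cont_plus; apply cont_pow.
  - apply cont_plus; [now apply cont_cos | apply continuous_const].
  - apply cont_mult; [apply continuous_const | now apply cont_sin].
Qed.

Lemma cont_speed_ellipse {U : UniformSpace} (hI mu b x0 : R) (xi : U -> R) (x : U) :
  ellipse b x0 (xi x) <> 0%C -> continuous xi x ->
  continuous (fun y => sqrt (2 * V_I hI mu (ellipse b x0 (xi y)))) x.
Proof.
  intros N C. unfold V_I.
  apply cont_sqrt, cont_mult; [apply continuous_const |].
  apply cont_plus; [apply continuous_const |].
  apply cont_div; [|apply continuous_const | now apply cont_Cmod_ellipse].
  pose proof (proj1 (Cmod_gt_0 _) N). lra.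
Qed.

Lemma cont_normal_length {U : UniformSpace} (b : R) (xi : U -> R) (x : U) :
  continuous xi x ->
  continuous (fun y => sqrt (sin (xi y) ^ 2 + (b * cos (xi y)) ^ 2)) x.
Proof.
  intros C. apply cont_sqrt, cont_plus; apply cont_pow.
  - now apply cont_sin.
  - apply cont_mult; [apply continuous_const | now apply cont_cos].
Qed.

Lemma normal_length_0 (b : R) : 0 < b -> sqrt (sin 0 ^ 2 + (b * cos 0) ^ 2) = b.
Proof.
  intros Hb. rewrite sin_0, cos_0. replace (0 ^ 2 + (b * 1) ^ 2) with (Rsqr b)
    by (unfold Rsqr; ring).
  apply sqrt_Rsqr. lra.
Qed.

Lemma speed_0 (hI mu b x0 : R) :
  -1 < x0 -> sqrt (2 * V_I hI mu (ellipse b x0 0)) = boundary_speed hI mu (1 + x0).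
Proof.
  intros Hx. rewrite ellipse_0. unfold V_I. now rewrite Cmod_pos_real by lra.
Qed.

Lemma cont_arc_start_fst (b x0 : R) :
  continuous (fun p => fst (arc_start b x0 p)) (0, 0).
Proof.
  unfold arc_start, csqrt. simpl fst.
  apply cont_sqrt, cont_div; [lra | | apply continuous_const].
  apply cont_plus.
  - apply (cont_Cmod_ellipse b x0 (fun p : R * R => fst p)), continuous_fst.
  - unfold ellipse; simpl. apply cont_plus; [|apply continuous_const].
    apply (cont_cos (fun p : R * R => fst p)), continuous_fst.
Qed.

Lemma arc_start_fst_0 (b x0 : R) :
  -1 < x0 -> fst (arc_start b x0 (0, 0)) = sqrt (1 + x0).
Proof.
  intros Hx.
  change (sqrt ((Cmod (ellipse b x0 0) + fst (ellipse b x0 0)) / 2) = sqrt (1 + x0)).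
  rewrite ellipse_0, Cmod_pos_real by lra.
  simpl. f_equal. field.
Qed.

Lemma slopes_sin (f : R * R -> R) (a b : R) :
  vanishes_with_slopes f a b -> vanishes_with_slopes (fun p => sin (f p)) a b.
Proof.
  intros S.
  assert (D : is_derive sin 0 1) by (auto_derive; [auto | rewrite cos_0; ring]).
  apply (slopes_ext _ _ _ _ _ _ (slopes_comp sin 1 f a b D sin_0 S));
    [reflexivity | ring | ring].
Qed.

Lemma slopes_asin (f : R * R -> R) (a b : R) :
  vanishes_with_slopes f a b -> vanishes_with_slopes (fun p => asin (f p)) a b.
Proof.
  intros S.
  assert (D : is_derive asin 0 1).
  { apply is_derive_Reals.
    assert (I : -1 < 0 < 1) by lra.
    pose proof (derive_pt_asin 0 I) as E.
    replace (sqrt (1 - 0²)) with 1 in E.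
    - replace (1 / 1) with 1 in E by field.
      apply (proj1 (derive_pt_eq _ _ _ _) E).
    - unfold Rsqr. rewrite Rmult_0_l, Rminus_0_r. now rewrite sqrt_1. }
  apply (slopes_ext _ _ _ _ _ _ (slopes_comp asin 1 f a b D asin_0 S));
    [reflexivity | ring | ring].
Qed.

Lemma slopes_arc_start_snd (b x0 : R) :
  -1 < x0 ->
  vanishes_with_slopes (fun p => snd (arc_start b x0 p)) (b / (2 * sqrt (1 + x0))) 0.
Proof.
  intros Hx. assert (Pr : 0 < sqrt (1 + x0)) by (apply sqrt_lt_R0; lra).
  pose proof (arc_start_fst_0 b x0 Hx) as E0.
  assert (C : continuous (fun p => b / (2 * fst (arc_start b x0 p))) (0, 0)).
  { apply cont_div.
    - rewrite E0. lra.
    - apply continuous_const.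
    - apply cont_mult; [apply continuous_const | apply cont_arc_start_fst]. }
  apply (slopes_ext _ _ _ _ _ _ (slopes_mult _ _ _ _ C (slopes_sin _ _ _ slopes_fst))).
  - intros p. unfold arc_start, csqrt. simpl.
    match goal with |- context [sqrt ?u] => set (r := sqrt u) end.
    unfold Rdiv. ring.
  - rewrite E0. field. lra.
  - ring.
Qed.

Lemma cont_launch_fst (hI mu b x0 : R) :
  0 < b -> -1 < x0 < 1 ->
  continuous (fun p : R * R => fst (launch hI mu (ellipse b x0) (fst p) (snd p))) (0, 0).
Proof.
  intros Hb Hx.
  pose proof (sqrt_lt_R0 _ (sin2_cos2_weighted_pos b 0 Hb)) as Pn.
  apply (continuous_ext (fun p : R * R => sqrt (2 * V_I hI mu (ellipse b x0 (fst p)))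
    * (cos (snd p) * (- (b * cos (fst p)) / sqrt (sin (fst p) ^ 2 + (b * cos (fst p)) ^ 2))
       - sin (snd p) * (- sin (fst p) / sqrt (sin (fst p) ^ 2 + (b * cos (fst p)) ^ 2))))).
  { intros p. rewrite launch_coordinates, inward_normal_ellipse by exact Hb. reflexivity. }
  assert (C1 : continuous (fun p : R * R => fst p) (0, 0)) by apply continuous_fst.
  assert (C2 : continuous (fun p : R * R => snd p) (0, 0)) by apply continuous_snd.
  apply cont_mult; [apply (cont_speed_ellipse hI mu b x0 (fun p : R * R => fst p));
                    [now apply ellipse_neq_0 | exact C1] |].
  apply cont_minus; apply cont_mult.
  - now apply cont_cos.
  - apply cont_div; [exact (Rgt_not_eq _ _ Pn) | | now apply cont_normal_length].
    apply cont_opp, cont_mult; [apply continuous_const | now apply cont_cos].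
  - now apply cont_sin.
  - apply cont_div; [exact (Rgt_not_eq _ _ Pn) | | now apply cont_normal_length].
    now apply cont_opp, cont_sin.
Qed.

Lemma launch_fst_0 (hI mu b x0 : R) :
  0 < b -> -1 < x0 ->
  fst (launch hI mu (ellipse b x0) 0 0) = - boundary_speed hI mu (1 + x0).
Proof.
  intros Hb Hx. rewrite launch_coordinates, inward_normal_ellipse by exact Hb.
  rewrite normal_length_0 by exact Hb. rewrite speed_0 by exact Hx.
  simpl. rewrite cos_0, sin_0. field. lra.
Qed.

Lemma slopes_launch_snd (hI mu b x0 : R) :
  0 < b -> -1 < x0 < 1 ->
  let v := boundary_speed hI mu (1 + x0) in
  vanishes_with_slopes (fun p => snd (launch hI mu (ellipse b x0) (fst p) (snd p)))
    (- (v / b)) (- v).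
Proof.
  intros Hb Hx v.
  pose proof (sqrt_lt_R0 _ (sin2_cos2_weighted_pos b 0 Hb)) as Pn.
  assert (C1 : continuous (fun p : R * R => fst p) (0, 0)) by apply continuous_fst.
  assert (C2 : continuous (fun p : R * R => snd p) (0, 0)) by apply continuous_snd.
  assert (Cv : continuous (fun p : R * R => sqrt (2 * V_I hI mu (ellipse b x0 (fst p)))) (0, 0)).
  { apply (cont_speed_ellipse hI mu b x0 (fun p : R * R => fst p));
      [now apply ellipse_neq_0 | exact C1]. }
  assert (K1 : continuous (fun p : R * R => sqrt (2 * V_I hI mu (ellipse b x0 (fst p)))
             * (- cos (snd p) / sqrt (sin (fst p) ^ 2 + (b * cos (fst p)) ^ 2))) (0, 0)).
  { apply cont_mult; [exact Cv |].
    apply cont_div; [exact (Rgt_not_eq _ _ Pn) | | now apply cont_normal_length].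
    now apply cont_opp, cont_cos. }
  assert (K2 : continuous (fun p : R * R => sqrt (2 * V_I hI mu (ellipse b x0 (fst p)))
             * (- (b * cos (fst p)) / sqrt (sin (fst p) ^ 2 + (b * cos (fst p)) ^ 2))) (0, 0)).
  { apply cont_mult; [exact Cv |].
    apply cont_div; [exact (Rgt_not_eq _ _ Pn) | | now apply cont_normal_length].
    apply cont_opp, cont_mult; [apply continuous_const | now apply cont_cos]. }
  apply (slopes_ext _ _ _ _ _ _
    (slopes_plus _ _ _ _ _ _
       (slopes_mult _ _ _ _ K1 (slopes_sin _ _ _ slopes_fst))
       (slopes_mult _ _ _ _ K2 (slopes_sin _ _ _ slopes_snd)))).
  - intros p. rewrite launch_coordinates, inward_normal_ellipse by exact Hb.
    simpl. unfold Rdiv. ring.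
  - simpl fst; simpl snd. rewrite normal_length_0, speed_0, cos_0 by lra.
    fold v. field. lra.
  - simpl fst; simpl snd. rewrite normal_length_0, speed_0, cos_0 by lra.
    fold v. field. lra.
Qed.

Definition first_exit (g : R -> R) (S : R) : Prop :=
  0 < S /\ g S = 0 /\ forall s, 0 < s < S -> g s < 0.

Lemma first_exit_unique (g : R -> R) (S S' : R) :
  first_exit g S -> first_exit g S' -> S = S'.
Proof.
  intros [P [Z N]] [P' [Z' N']].
  destruct (Rtotal_order S S') as [L | [L | L]]; auto.
  - pose proof (N' S ltac:(lra)). lra.
  - pose proof (N S' ltac:(lra)). lra.
Qed.

Lemma first_exit_time_continuous {U : UniformSpace} (p0 : U) (G H : R -> U -> R) (S0 : R) :
  (forall s p, is_derive (fun s => G s p) s (H s p)) ->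
  (forall s, continuous (fun q : R * U => G (fst q) (snd q)) (s, p0)) ->
  (forall s, continuous (fun q : R * U => H (fst q) (snd q)) (s, p0)) ->
  locally p0 (fun p => G 0 p = 0) ->
  first_exit (fun s => G s p0) S0 -> H 0 p0 < 0 -> 0 < H S0 p0 ->
  exists S : U -> R, S p0 = S0 /\ continuous S p0 /\
    locally p0 (fun p => first_exit (fun s => G s p) (S p)).
Proof.
  intros D CG CH G0 X0 H0 HS. pose proof X0 as [P0 [Z0 N0]].
  set (S := fun p => epsilon (inhabits S0) (first_exit (fun s => G s p))).
  assert (Spec : forall p S', first_exit (fun s => G s p) S' -> S p = S').
  { intros p S' X. apply (first_exit_unique (fun s => G s p)); [|exact X].
    unfold S. apply epsilon_spec. now exists S'. }
  pose proof (fun eps => first_exit_near p0 G H S0 eps D CG CH G0 P0 Z0 H0 HS N0) as Near.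
  exists S. split; [now apply Spec | split].
  - intros P [eps HP]. rewrite (Spec p0 S0 X0) in HP.
    change (locally p0 (fun p => P (S p))).
    generalize (Near eps (cond_pos eps)). apply filter_imp.
    intros p [S' [P' [L' [Z' N']]]]. apply HP.
    rewrite (Spec p S') by (repeat split; assumption). exact L'.
  - generalize (Near 1 Rlt_0_1). apply filter_imp.
    intros p [S' [P' [_ [Z' N']]]].
    assert (X : first_exit (fun s => G s p) S') by (repeat split; assumption).
    now rewrite (Spec p S' X).
Qed.

Lemma cont_arc_start_snd (b x0 : R) :
  -1 < x0 -> continuous (fun p => snd (arc_start b x0 p)) (0, 0).
Proof. intros Hx. exact (slopes_continuous _ _ _ (slopes_arc_start_snd b x0 Hx)). Qed.

Lemma cont_arc_start'_fst (hI mu b x0 : R) :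
  0 < b -> -1 < x0 < 1 -> continuous (fun p => fst (arc_start' hI mu b x0 p)) (0, 0).
Proof.
  intros Hb Hx. unfold arc_start', lc_launch. simpl fst.
  apply cont_div; [lra | | apply continuous_const].
  apply cont_plus; apply cont_mult.
  - now apply cont_launch_fst.
  - apply cont_arc_start_fst.
  - exact (slopes_continuous _ _ _ (slopes_launch_snd hI mu b x0 Hb Hx)).
  - now apply cont_arc_start_snd.
Qed.

Lemma arc_start_snd_0 (b x0 : R) : -1 < x0 -> snd (arc_start b x0 (0, 0)) = 0.
Proof. intros Hx. exact (slopes_0 _ _ _ (slopes_arc_start_snd b x0 Hx)). Qed.

Lemma arc_start'_fst_0 (hI mu b x0 : R) :
  0 < b -> -1 < x0 < 1 ->
  fst (arc_start' hI mu b x0 (0, 0))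
    = - (boundary_speed hI mu (1 + x0) * sqrt (1 + x0) / 2).
Proof.
  intros Hb Hx. unfold arc_start', lc_launch. cbn [fst snd].
  rewrite arc_start_fst_0, arc_start_snd_0, launch_fst_0 by lra. field.
Qed.

Lemma slopes_arc_start'_snd (hI mu b x0 : R) :
  0 < b -> -1 < x0 < 1 ->
  let v := boundary_speed hI mu (1 + x0) in
  let q := sqrt (1 + x0) in
  vanishes_with_slopes (fun p => snd (arc_start' hI mu b x0 p))
    (v * b / (4 * q) - v * q / (2 * b)) (- (v * q / 2)).
Proof.
  intros Hb Hx v q.
  assert (Pq : 0 < q) by (apply sqrt_lt_R0; lra).
  assert (K1 : continuous (fun p => / 2 * fst (arc_start b x0 p)) (0, 0)).
  { apply cont_mult; [apply continuous_const | apply cont_arc_start_fst]. }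
  assert (K2 : continuous (fun p : R * R =>
            - / 2 * fst (launch hI mu (ellipse b x0) (fst p) (snd p))) (0, 0)).
  { apply cont_mult; [apply continuous_const | now apply cont_launch_fst]. }
  apply (slopes_ext _ _ _ _ _ _
    (slopes_plus _ _ _ _ _ _
       (slopes_mult _ _ _ _ K1 (slopes_launch_snd hI mu b x0 Hb Hx))
       (slopes_mult _ _ _ _ K2 (slopes_arc_start_snd b x0 (proj1 Hx))))).
  - intros p. unfold arc_start', lc_launch. cbn [fst snd]. field.
  - cbn [fst snd]. rewrite arc_start_fst_0, launch_fst_0 by lra. fold v q. field. lra.
  - cbn [fst snd]. rewrite arc_start_fst_0, launch_fst_0 by lra. fold v q. field.
Qed.

Lemma arc_start'_snd_0 (hI mu b x0 : R) :
  0 < b -> -1 < x0 < 1 -> snd (arc_start' hI mu b x0 (0, 0)) = 0.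
Proof. intros Hb Hx. exact (slopes_0 _ _ _ (slopes_arc_start'_snd hI mu b x0 Hb Hx)). Qed.

(** Time and parameter may depend on any variable: it is [(s, p)] in the search for
    the exit, and the parameter alone once the exit time is a function of it. *)
Lemma cont_arc {U : UniformSpace} (hI mu b x0 : R) (s : U -> R) (p : U -> R * R) (x : U) :
  0 < b -> -1 < x0 < 1 -> continuous s x -> continuous p x -> p x = (0, 0) ->
  continuous (fun y => fst (arc_pos hI mu b x0 (s y) (p y))) x /\
  continuous (fun y => snd (arc_pos hI mu b x0 (s y) (p y))) x /\
  continuous (fun y => fst (arc_vel hI mu b x0 (s y) (p y))) x /\
  continuous (fun y => snd (arc_vel hI mu b x0 (s y) (p y))) x.
Proof.
  intros Hb Hx Cs Cp E.
  assert (K : forall f : R * R -> R, continuous f (0, 0) -> continuous (fun y => f (p y)) x).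
  { intros f Cf. apply continuous_comp; [exact Cp |]. now rewrite E. }
  pose proof (K _ (cont_arc_start_fst b x0)) as C1.
  pose proof (K _ (cont_arc_start_snd b x0 (proj1 Hx))) as C2.
  pose proof (K _ (cont_arc_start'_fst hI mu b x0 Hb Hx)) as C3.
  pose proof (K _ (slopes_continuous _ _ _ (slopes_arc_start'_snd hI mu b x0 Hb Hx))) as C4.
  unfold arc_pos, arc_vel, lc_pos, lc_vel. cbn [fst snd].
  repeat split; solve [now apply cont_hyper | now apply cont_hyper'].
Qed.

(** The perturbations transverse to the homothetic arc obey the same linear
    equation; only the value of the time [S] at [(0, 0)] enters their slopes. *)
Lemma slopes_arc_snd (hI mu b x0 : R) (S : R * R -> R) :
  0 < b -> -1 < x0 < 1 -> continuous S (0, 0) ->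
  let v := boundary_speed hI mu (1 + x0) in
  let q := sqrt (1 + x0) in
  let y := b / (2 * q) in
  let y' := v * b / (4 * q) - v * q / (2 * b) in
  vanishes_with_slopes (fun p => snd (arc_pos hI mu b x0 (S p) p))
    (hyper hI y y' (S (0, 0))) (hyper hI 0 (- (v * q / 2)) (S (0, 0))) /\
  vanishes_with_slopes (fun p => snd (arc_vel hI mu b x0 (S p) p))
    (hyper' hI y y' (S (0, 0))) (hyper' hI 0 (- (v * q / 2)) (S (0, 0))).
Proof.
  intros Hb Hx CS v q y y'.
  set (k := sqrt (hI / 2)).
  assert (Ck : continuous (fun p => k * S p) (0, 0)).
  { apply cont_mult; [apply continuous_const | exact CS]. }
  pose proof (slopes_arc_start_snd b x0 (proj1 Hx)) as Y0.
  pose proof (slopes_arc_start'_snd hI mu b x0 Hb Hx) as Y1.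
  split.
  - assert (C1 : continuous (fun p => cosh (k * S p)) (0, 0)) by now apply cont_cosh.
    assert (C2 : continuous (fun p => sinh (k * S p) / k) (0, 0)).
    { apply (cont_mult _ (fun _ => / k)); [now apply cont_sinh | apply continuous_const]. }
    apply (slopes_ext _ _ _ _ _ _
      (slopes_plus _ _ _ _ _ _ (slopes_mult _ _ _ _ C1 Y0) (slopes_mult _ _ _ _ C2 Y1))).
    + intros p. unfold arc_pos, lc_pos, hyper. cbn [snd]. fold k. ring.
    + unfold hyper. fold k q v. unfold y, y'. ring.
    + unfold hyper. fold k q v. ring.
  - assert (C1 : continuous (fun p => k * sinh (k * S p)) (0, 0)).
    { apply cont_mult; [apply continuous_const | now apply cont_sinh]. }
    assert (C2 : continuous (fun p => cosh (k * S p)) (0, 0)) by now apply cont_cosh.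
    apply (slopes_ext _ _ _ _ _ _
      (slopes_plus _ _ _ _ _ _ (slopes_mult _ _ _ _ C1 Y0) (slopes_mult _ _ _ _ C2 Y1))).
    + intros p. unfold arc_vel, lc_vel, hyper'. cbn [snd]. fold k. ring.
    + unfold hyper'. fold k q v. unfold y, y'. ring.
    + unfold hyper'. fold k q v. ring.
Qed.

(** On the homothetic arc, of real part [X], the equation of the ellipse reads
    [(X^2 - x0)^2 - 1], negative while [X^2 < 1 + x0]; its derivative is [- 2 v r] at
    the start and [2 v r] at the end, [r = 1 + x0]. *)
Lemma exit_time (hI mu b x0 S0 : R) :
  0 < hI -> 0 < mu -> 0 < b -> -1 < x0 < 1 ->
  let v := boundary_speed hI mu (1 + x0) in
  let q := sqrt (1 + x0) in
  0 < S0 -> hyper hI q (- (v * q / 2)) S0 = - q ->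
  hyper' hI q (- (v * q / 2)) S0 = - (v * q / 2) ->
  (forall s, 0 < s < S0 -> hyper hI q (- (v * q / 2)) s ^ 2 < 1 + x0) ->
  exists S : R * R -> R, S (0, 0) = S0 /\ continuous S (0, 0) /\
    locally ((0, 0) : R * R)
      (fun p => first_exit (fun s => exit_fun hI mu b x0 s p) (S p)).
Proof.
  intros Hh Hm Hb Hx v q HS0 EX EX' Hin.
  assert (Pq : 0 < q) by (apply sqrt_lt_R0; lra).
  assert (Eq : q ^ 2 = 1 + x0) by (apply pow2_sqrt; lra).
  assert (Pv : 0 < v) by (apply boundary_speed_pos; lra).
  assert (P0 : forall s, arc_pos hI mu b x0 s (0, 0) = (hyper hI q (- (v * q / 2)) s, 0)).
  { intros s. unfold arc_pos, lc_pos.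
    rewrite arc_start_fst_0, arc_start_snd_0, arc_start'_fst_0, arc_start'_snd_0 by lra.
    fold v q. f_equal. unfold hyper. ring. }
  assert (V0 : forall s, arc_vel hI mu b x0 s (0, 0) = (hyper' hI q (- (v * q / 2)) s, 0)).
  { intros s. unfold arc_vel, lc_vel.
    rewrite arc_start_fst_0, arc_start_snd_0, arc_start'_fst_0, arc_start'_snd_0 by lra.
    fold v q. f_equal. unfold hyper'. ring. }
  assert (CA : forall s, let pt := ((s, (0, 0)) : R * (R * R)) in
    continuous (fun y : R * (R * R) => fst (arc_pos hI mu b x0 (fst y) (snd y))) pt /\
    continuous (fun y : R * (R * R) => snd (arc_pos hI mu b x0 (fst y) (snd y))) pt /\
    continuous (fun y : R * (R * R) => fst (arc_vel hI mu b x0 (fst y) (snd y))) pt /\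
    continuous (fun y : R * (R * R) => snd (arc_vel hI mu b x0 (fst y) (snd y))) pt).
  { intros s pt.
    apply (cont_arc hI mu b x0 (fun y : R * (R * R) => fst y)
             (fun y : R * (R * R) => snd y)); auto.
    - apply continuous_fst.
    - apply continuous_snd. }
  apply (first_exit_time_continuous ((0, 0) : R * R) (exit_fun hI mu b x0)
           (exit_fun' hI mu b x0) S0).
  - intros s p. now apply is_derive_exit_fun.
  - intros s. destruct (CA s) as [C1 [C2 [C3 C4]]].
    unfold exit_fun, ellipse_eq, Cmult. cbn [fst snd].
    apply cont_minus; [|apply continuous_const].
    apply cont_plus; apply cont_pow.
    + apply cont_minus; [|apply continuous_const].
      apply cont_minus; now apply cont_mult.
    + apply cont_div; [lra | | apply continuous_const].
      apply cont_plus; now apply cont_mult.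
  - intros s. destruct (CA s) as [C1 [C2 [C3 C4]]].
    unfold exit_fun', Cmult. cbn [fst snd].
    apply cont_plus; apply cont_mult.
    + apply cont_mult; [apply continuous_const |].
      apply cont_minus; [|apply continuous_const].
      apply cont_minus; now apply cont_mult.
    + apply cont_minus; now apply cont_mult.
    + apply cont_mult; [apply continuous_const |].
      apply cont_div; [nra | | apply continuous_const].
      apply cont_plus; now apply cont_mult.
    + apply cont_plus; now apply cont_mult.
  - assert (C : continuous (fun p : R * R =>
      Cmod (ellipse b x0 (fst p)) + fst (ellipse b x0 (fst p))) (0, 0)).
    { apply cont_plus.
      - apply (cont_Cmod_ellipse b x0 (fun p : R * R => fst p)), continuous_fst.
      - unfold ellipse. cbn [fst snd]. apply cont_plus; [|apply continuous_const].
        apply (cont_cos (fun p : R * R => fst p)), continuous_fst. }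
    apply continuous_locally_pos in C.
    + revert C. apply filter_imp. intros p Hp. unfold exit_fun, arc_pos.
      rewrite lc_pos_0 by exact Hh. unfold arc_start. rewrite csqrt_sqr by exact Hp.
      now apply ellipse_eq_ellipse.
    + cbn [fst snd]. rewrite ellipse_0, Cmod_pos_real by lra. cbn [fst]. lra.
  - unfold first_exit. unfold exit_fun, ellipse_eq. split; [exact HS0 | split].
    + rewrite P0, EX. cbn [fst snd Cmult].
      replace (- q * - q - 0 * 0) with (q ^ 2) by ring. rewrite Eq. field. lra.
    + intros s Hs. rewrite P0. specialize (Hin s Hs).
      set (X := hyper hI q (- (v * q / 2)) s) in *. cbn [fst snd Cmult].
      replace ((X * 0 + 0 * X) / b) with 0 by (field; lra).
      replace (X * X - 0 * 0) with (X ^ 2) by ring.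
      pose proof (pow2_ge_0 X). nra.
  - unfold exit_fun'. rewrite P0, V0, hyper_0, hyper'_0 by exact Hh. cbn [fst snd Cmult].
    replace (q * q - 0 * 0 - x0) with 1 by nra.
    replace (q * - (v * q / 2) - 0 * 0) with (- (v * q ^ 2 / 2)) by field.
    rewrite Eq.
    replace ((q * 0 + 0 * q) / b ^ 2) with 0 by (field; lra). nra.
  - unfold exit_fun'. rewrite P0, V0, EX, EX'. cbn [fst snd Cmult].
    replace (- q * - q - 0 * 0 - x0) with 1 by nra.
    replace (- q * - (v * q / 2) - 0 * 0) with (v * q ^ 2 / 2) by field.
    rewrite Eq.
    replace ((- q * 0 + 0 * - q) / b ^ 2) with 0 by (field; lra). nra.
Qed.

(** * The first return map near the homothetic arc *)

Lemma cont_inward_normal_ellipse {U : UniformSpace} (b x0 : R) (xi : U -> R) (x : U) :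
  0 < b -> continuous xi x ->
  continuous (fun y => fst (inward_normal (ellipse b x0) (xi y))) x /\
  continuous (fun y => snd (inward_normal (ellipse b x0) (xi y))) x.
Proof.
  intros Hb C.
  pose proof (sqrt_lt_R0 _ (sin2_cos2_weighted_pos b (xi x) Hb)) as Pn.
  split.
  - apply (continuous_ext
      (fun y => - (b * cos (xi y)) / sqrt (sin (xi y) ^ 2 + (b * cos (xi y)) ^ 2))).
    { intros y. now rewrite inward_normal_ellipse. }
    apply cont_div; [lra | | now apply cont_normal_length].
    apply cont_opp, cont_mult; [apply continuous_const | now apply cont_cos].
  - apply (continuous_ext
      (fun y => - sin (xi y) / sqrt (sin (xi y) ^ 2 + (b * cos (xi y)) ^ 2))).
    { intros y. now rewrite inward_normal_ellipse. }
    apply cont_div; [lra | | now apply cont_normal_length].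
    now apply cont_opp, cont_sin.
Qed.

Lemma inward_normal_ellipse_0 (b x0 : R) :
  0 < b -> inward_normal (ellipse b x0) 0 = (-1, 0).
Proof.
  intros Hb. rewrite inward_normal_ellipse, normal_length_0 by exact Hb.
  rewrite sin_0, cos_0. f_equal; field; lra.
Qed.

Lemma slopes_inward_normal_snd (b x0 : R) (xi : R * R -> R) (a1 a2 : R) :
  0 < b -> vanishes_with_slopes xi a1 a2 ->
  vanishes_with_slopes (fun p => snd (inward_normal (ellipse b x0) (xi p)))
    (- a1 / b) (- a2 / b).
Proof.
  intros Hb Sx. pose proof (slopes_continuous _ _ _ Sx) as C.
  pose proof (slopes_0 _ _ _ Sx) as Z.
  pose proof (sqrt_lt_R0 _ (sin2_cos2_weighted_pos b (xi (0, 0)) Hb)) as Pn.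
  assert (K : continuous (fun p => - 1 / sqrt (sin (xi p) ^ 2 + (b * cos (xi p)) ^ 2)) (0, 0)).
  { apply cont_div; [lra | apply continuous_const | now apply cont_normal_length]. }
  apply (slopes_ext _ _ _ _ _ _ (slopes_mult _ _ _ _ K (slopes_sin _ _ _ Sx))).
  - intros p. rewrite inward_normal_ellipse by exact Hb. cbn [snd]. unfold Rdiv. ring.
  - rewrite Z, normal_length_0 by exact Hb. field. lra.
  - rewrite Z, normal_length_0 by exact Hb. field. lra.
Qed.

Lemma ellipse_interior_iff (b x0 : R) (z : C) :
  ellipse_interior b x0 z <-> ellipse_eq b x0 z < 0.
Proof. unfold ellipse_interior, ellipse_eq. split; intros; lra. Qed.

Definition exit_angle (hI mu b x0 : R) (S : R * R -> R) (p : R * R) : R :=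
  let w := arc_pos hI mu b x0 (S p) p in
  asin (snd (w * w)%C / b).

Definition exit_speed (hI mu b x0 : R) (S : R * R -> R) (p : R * R) : C :=
  lc_speed (arc_pos hI mu b x0 (S p) p) (arc_vel hI mu b x0 (S p) p).

Definition reflected_angle (hI mu b x0 : R) (S : R * R -> R) (p : R * R) : R :=
  let xi1 := exit_angle hI mu b x0 S p in
  asin (dot (exit_speed hI mu b x0 S p) (Ci * inward_normal (ellipse b x0) xi1)%C
        / sqrt (2 * V_I hI mu (ellipse b x0 xi1))).

(** Arcs that start near the homothetic one leave the ellipse on its right half and
    pointing outwards, where the two arcsines recover [xi1] and [alpha1] from the
    state at the first exit. *)
Lemma return_map_near_0 (hI mu b x0 : R) (S : R * R -> R) :
  0 < hI -> 0 < mu -> 0 < b -> -1 < x0 < 1 ->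
  locally ((0, 0) : R * R)
    (fun p => first_exit (fun s => exit_fun hI mu b x0 s p) (S p)) ->
  locally ((0, 0) : R * R)
    (fun p => let w := arc_pos hI mu b x0 (S p) p in 0 < fst (w * w)%C - x0) ->
  locally ((0, 0) : R * R)
    (fun p => dot (exit_speed hI mu b x0 S p)
                (inward_normal (ellipse b x0) (exit_angle hI mu b x0 S p)) < 0) ->
  return_map_near hI mu (ellipse b x0) (ellipse_interior b x0) 0
    (fun p => (exit_angle hI mu b x0 S p, reflected_angle hI mu b x0 S p)).
Proof.
  intros Hh Hm Hb Hx LS Lz Ld.
  assert (La : locally ((0, 0) : R * R) (fun p => Rabs (snd p) < PI / 2)).
  { exists (mkposreal _ PI2_RGT_0). intros p [_ Hp].
    change (Rabs (snd p - 0) < PI / 2) in Hp. now rewrite Rminus_0_r in Hp. }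
  assert (Lr : locally ((0, 0) : R * R)
            (fun p => 0 < Cmod (ellipse b x0 (fst p)) + fst (ellipse b x0 (fst p)))).
  { apply (continuous_locally_pos
      (fun p : R * R => Cmod (ellipse b x0 (fst p)) + fst (ellipse b x0 (fst p)))).
    - apply cont_plus.
      + apply (cont_Cmod_ellipse b x0 (fun p : R * R => fst p)), continuous_fst.
      + unfold ellipse. cbn [fst snd]. apply cont_plus; [|apply continuous_const].
        apply (cont_cos (fun p : R * R => fst p)), continuous_fst.
    - cbn [fst snd]. rewrite ellipse_0, Cmod_pos_real by lra. cbn [fst]. lra. }
  unfold return_map_near.
  generalize (filter_and _ _ LS (filter_and _ _ Lz (filter_and _ _ Ld
                (filter_and _ _ La Lr)))).
  apply filter_imp. intros p [PS [Pz [Pd [Pa Pr]]]] q.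
  cbv zeta in Pz.
  set (gamma := ellipse b x0) in *.
  assert (Hsq : (arc_start b x0 p * arc_start b x0 p)%C = gamma (fst p)).
  { now apply csqrt_sqr. }
  assert (HV : forall xi, 0 < V_I hI mu (gamma xi)).
  { intros xi. apply V_I_pos; auto. now apply ellipse_neq_0. }
  assert (N0 : dot (arc_start b x0 p) (arc_start b x0 p) <> 0).
  { apply Csqr_neq_0. rewrite Hsq. now apply ellipse_neq_0. }
  assert (HE : lc_energy hI mu (arc_start b x0 p) (arc_start' hI mu b x0 p)).
  { apply lc_launch_energy; [exact N0 |]. rewrite Hsq. apply launch_norm; auto.
    now apply tangent_ellipse_neq_0. }
  assert (HL : launch hI mu gamma (fst p) (snd p)
               = lc_speed (arc_start b x0 p) (arc_start' hI mu b x0 p)).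
  { symmetry. now apply lc_speed_launch. }
  pose proof (first_return_lc_iff hI mu gamma (ellipse_interior b x0) p q _ _ Hh Hm HE N0
                (eq_sym Hsq) HL (ellipse_neq_0 b x0 (fst q) Hb Hx)) as FR.
  cbv zeta in FR.
  change (lc_pos hI (arc_start b x0 p) (arc_start' hI mu b x0 p))
    with (fun s => arc_pos hI mu b x0 s p) in FR.
  change (lc_vel hI (arc_start b x0 p) (arc_start' hI mu b x0 p))
    with (fun s => arc_vel hI mu b x0 s p) in FR.
  cbv beta in FR.
  pose proof PS as [PS0 [PS1 PS2]].
  pose proof (ellipse_right_half_iff b x0 (fst q) _ Hb PS1 Pz) as RH.
  assert (Hz1 : (arc_pos hI mu b x0 (S p) p * arc_pos hI mu b x0 (S p) p)%C
                = gamma (exit_angle hI mu b x0 S p)).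
  { apply (ellipse_right_half_iff b x0 _ _ Hb PS1 Pz). reflexivity. }
  assert (HV1 : dot (exit_speed hI mu b x0 S p) (exit_speed hI mu b x0 S p)
                = 2 * V_I hI mu (gamma (exit_angle hI mu b x0 S p))).
  { rewrite <- Hz1. apply lc_speed_energy.
    - now apply lc_energy_conserved.
    - apply Csqr_neq_0. rewrite Hz1. now apply ellipse_neq_0. }
  pose proof (reflect_eq_launch_iff hI mu gamma (exit_angle hI mu b x0 S p) (snd q)
    (exit_speed hI mu b x0 S p) (tangent_ellipse_neq_0 b x0 _ Hb) (HV _) HV1 Pd) as RL.
  rewrite Rminus_0_r. split.
  - intros [HF Hq]. apply FR in HF.
    destruct HF as [_ [Haq [T [HT [HTin [HTz HTv]]]]]].
    assert (XT : first_exit (fun s => exit_fun hI mu b x0 s p) T).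
    { split; [exact HT | split].
      - unfold exit_fun. rewrite HTz. now apply ellipse_eq_ellipse.
      - intros s Hs. apply ellipse_interior_iff. now apply HTin. }
    rewrite (first_exit_unique _ _ _ XT PS) in HTz, HTv.
    assert (E1 : fst q = exit_angle hI mu b x0 S p).
    { apply RH. split; [exact HTz | exact Hq]. }
    rewrite E1 in HTv.
    apply injective_projections; [exact E1 |].
    apply RL. split; [exact Haq | exact HTv].
  - intros Eq. pose proof (f_equal fst Eq) as E1. pose proof (f_equal snd Eq) as E2.
    cbn [fst snd] in E1, E2.
    apply RH in E1. destruct E1 as [E1 Hq]. split; [|exact Hq].
    apply RL in E2. destruct E2 as [Haq HTv].
    apply FR. split; [now apply Rabs_def2 in Pa | split; [exact Haq |]].
    exists (S p). split; [exact PS0 | split; [|split; [exact E1 |]]].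
    + intros s Hs. apply ellipse_interior_iff. now apply PS2.
    + replace (fst q) with (exit_angle hI mu b x0 S p)
        by (symmetry; apply RH; split; [exact E1 | exact Hq]).
      exact HTv.
Qed.

(** With [c = cosh (k S0)], [k = sqrt (hI / 2)], the Jacobian is the product of
    the linearised flow, a hyperbolic rotation of angle [k S0] in the transverse
    Levi-Civita coordinate, with the changes of coordinates at the boundary, where
    the curvature radius [b^2] of the vertex comes in. *)
Lemma return_jacobian_0 (hI mu b x0 : R) :
  0 < hI -> 0 < mu -> 0 < b -> -1 < x0 < 1 ->
  let r := 1 + x0 in
  let c := 2 * (hI + mu / r) * r / mu - 1 in
  let a := 2 * (c + 1) * r / b ^ 2 - (2 * c + 1) in
  return_jacobian hI mu (ellipse b x0) (ellipse_interior b x0) 0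
    a (2 * (c + 1) * r / b) (a / b - (2 * c + 1) / b + 2 * c * b / r) a.
Proof.
  intros Hh Hm Hb Hx r c a.
  assert (Hr : 0 < r) by (unfold r; lra).
  destruct (homothetic_arc hI mu r Hh Hm Hr)
    as [S0 [HS0 [Ech [Esh [EX [EX' Hin]]]]]].
  destruct (exit_time hI mu b x0 S0 Hh Hm Hb Hx HS0 EX EX' Hin) as [S [ES [CS LS]]].
  fold r in ES.
  set (v := boundary_speed hI mu r) in *.
  assert (Pv : 0 < v) by now apply boundary_speed_pos.
  assert (Ev : v ^ 2 = 2 * (hI + mu / r)) by now apply boundary_speed_sqr.
  set (q := sqrt r) in *.
  assert (Pq : 0 < q) by now apply sqrt_lt_R0.
  assert (Eq : q ^ 2 = r) by (apply pow2_sqrt; lra).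
  pose proof (slopes_arc_snd hI mu b x0 S Hb Hx CS) as [SY SY'].
  cbv zeta in SY, SY'. fold r in SY, SY'. fold v q in SY, SY'. rewrite ES in SY, SY'.
  destruct (cont_arc hI mu b x0 S (fun p => p) (0, 0) Hb Hx CS
              (continuous_id _) eq_refl) as [C1 [C2 [C3 C4]]].
  assert (X0 : fst (arc_pos hI mu b x0 (S (0, 0)) (0, 0)) = - q).
  { rewrite ES, <- EX. unfold arc_pos, lc_pos. cbn [fst].
    now rewrite arc_start_fst_0, arc_start'_fst_0 by lra. }
  assert (X0' : fst (arc_vel hI mu b x0 (S (0, 0)) (0, 0)) = - (v * q / 2)).
  { rewrite ES, <- EX'. unfold arc_vel, lc_vel. cbn [fst].
    now rewrite arc_start_fst_0, arc_start'_fst_0 by lra. }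
  pose proof (slopes_0 _ _ _ SY) as Y0. pose proof (slopes_0 _ _ _ SY') as Y0'.
  cbv beta in Y0, Y0'.
  (* The sine of [xi1] is [2 X Y / b], where [Y] vanishes at [(0, 0)]. *)
  set (y1 := hyper hI (b / (2 * q)) (v * b / (4 * q) - v * q / (2 * b)) S0) in *.
  set (y2 := hyper hI 0 (- (v * q / 2)) S0) in *.
  set (y1' := hyper' hI (b / (2 * q)) (v * b / (4 * q) - v * q / (2 * b)) S0) in *.
  set (y2' := hyper' hI 0 (- (v * q / 2)) S0) in *.
  set (a1 := - (2 * q / b) * y1). set (a2 := - (2 * q / b) * y2).
  assert (SXi : vanishes_with_slopes (exit_angle hI mu b x0 S) a1 a2).
  { assert (K : continuous (fun p => 2 / b * fst (arc_pos hI mu b x0 (S p) p)) (0, 0)).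
    { apply cont_mult; [apply continuous_const | exact C1]. }
    apply slopes_asin.
    apply (slopes_ext _ _ _ _ _ _ (slopes_mult _ _ _ _ K SY)).
    - intros p. cbn [snd Cmult]. field. lra.
    - rewrite X0. unfold a1. field. lra.
    - rewrite X0. unfold a2. field. lra. }
  pose proof (slopes_continuous _ _ _ SXi) as CXi.
  pose proof (slopes_0 _ _ _ SXi) as Xi0.
  destruct (cont_inward_normal_ellipse b x0 _ _ Hb CXi) as [Cn1 Cn2].
  set (N := fun p => dot (arc_pos hI mu b x0 (S p) p) (arc_pos hI mu b x0 (S p) p)).
  assert (CN : continuous N (0, 0)).
  { unfold N, dot. apply cont_plus; now apply cont_mult. }
  assert (N0 : N (0, 0) = r).
  { unfold N, dot. rewrite X0, Y0, <- Eq. ring. }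
  assert (Cv1 : continuous (fun p => fst (exit_speed hI mu b x0 S p)) (0, 0)).
  { unfold exit_speed, lc_speed. cbn [fst]. apply cont_div; [fold (N (0, 0)); lra | | exact CN].
    apply cont_mult; [apply continuous_const |].
    apply cont_minus; now apply cont_mult. }
  assert (Ev1 : fst (exit_speed hI mu b x0 S (0, 0)) = v).
  { unfold exit_speed, lc_speed. cbn [fst]. fold (N (0, 0)).
    rewrite X0, X0', Y0, Y0', N0, <- Eq. field. lra. }
  assert (Sv2 : vanishes_with_slopes (fun p => snd (exit_speed hI mu b x0 S p))
                  (- (2 / q) * y1' - v / q * y1) (- (2 / q) * y2' - v / q * y2)).
  { assert (K1 : continuous (fun p => 2 * fst (arc_pos hI mu b x0 (S p) p) / N p) (0, 0)).
    { apply cont_div; [lra | | exact CN].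
      apply cont_mult; [apply continuous_const | exact C1]. }
    assert (K2 : continuous (fun p => 2 * fst (arc_vel hI mu b x0 (S p) p) / N p) (0, 0)).
    { apply cont_div; [lra | | exact CN].
      apply cont_mult; [apply continuous_const | exact C3]. }
    apply (slopes_ext _ _ _ _ _ _ (slopes_plus _ _ _ _ _ _
             (slopes_mult _ _ _ _ K1 SY') (slopes_mult _ _ _ _ K2 SY))).
    - intros p. unfold exit_speed, lc_speed. cbn [snd]. fold (N p). unfold Rdiv. ring.
    - rewrite X0, X0', N0, <- Eq. field. lra.
    - rewrite X0, X0', N0, <- Eq. field. lra. }
  (* The sine of [alpha1] is [(v1 t1 + v2 t2) / |v|] with [t = i n]; both [t1], that
     is minus the second component of [n], and [v2] vanish at [(0, 0)]. *)
  set (d1 := a1 / b - (- (2 / q) * y1' - v / q * y1) / v).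
  set (d2 := a2 / b - (- (2 / q) * y2' - v / q * y2) / v).
  assert (SAl : vanishes_with_slopes (reflected_angle hI mu b x0 S) d1 d2).
  { assert (Cs : continuous (fun p => sqrt (2 * V_I hI mu
                   (ellipse b x0 (exit_angle hI mu b x0 S p)))) (0, 0)).
    { apply cont_speed_ellipse; [now apply ellipse_neq_0 | exact CXi]. }
    assert (Es : sqrt (2 * V_I hI mu (ellipse b x0 (exit_angle hI mu b x0 S (0, 0)))) = v).
    { rewrite Xi0. apply speed_0. lra. }
    set (sp := fun p => sqrt (2 * V_I hI mu (ellipse b x0 (exit_angle hI mu b x0 S p)))).
    change (continuous sp (0, 0)) in Cs. change (sp (0, 0) = v) in Es.
    assert (K1 : continuous (fun p => - fst (exit_speed hI mu b x0 S p) / sp p) (0, 0)).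
    { apply cont_div; [lra | now apply cont_opp | exact Cs]. }
    assert (K2 : continuous (fun p =>
      fst (inward_normal (ellipse b x0) (exit_angle hI mu b x0 S p)) / sp p) (0, 0)).
    { apply cont_div; [lra | exact Cn1 | exact Cs]. }
    apply slopes_asin.
    apply (slopes_ext _ _ _ _ _ _ (slopes_plus _ _ _ _ _ _
             (slopes_mult _ _ _ _ K1 (slopes_inward_normal_snd b x0 _ _ _ Hb SXi))
             (slopes_mult _ _ _ _ K2 Sv2))).
    - intros p. fold (sp p). set (n := inward_normal _ _). unfold dot. clearbody n.
      cbn [fst snd Cmult Ci]. unfold Rdiv. ring.
    - rewrite Ev1, Es, Xi0, inward_normal_ellipse_0 by exact Hb. cbn [fst].
      unfold d1. field. lra.
    - rewrite Ev1, Es, Xi0, inward_normal_ellipse_0 by exact Hb. cbn [fst].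
      unfold d2. field. lra. }
  (* Everything is now rational in [v], [q], [b] and [mu]. *)
  assert (Eh : hI = v ^ 2 / 2 - mu / q ^ 2) by (rewrite Eq; lra).
  assert (Ec : c = v ^ 2 * q ^ 2 / mu - 1).
  { unfold c. rewrite Ev, Eq. reflexivity. }
  assert (Eks : sqrt (hI / 2) * sinh (sqrt (hI / 2) * S0)
                = (v ^ 2 / 2 - mu / q ^ 2) * v * q ^ 2 / mu).
  { rewrite <- Eh, Eq. pose proof (frequency_pos hI Hh) as Pk.
    transitivity (sqrt (hI / 2) ^ 2 * (sinh (sqrt (hI / 2) * S0) / sqrt (hI / 2)));
      [field; lra |].
    rewrite Esh, frequency_sqr by exact Hh. field. lra. }
  fold c in Ech. rewrite <- Eq in Esh.
  assert (Ea1 : a1 = a).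
  { unfold a1, y1, hyper, a. rewrite Ech, Esh, Ec, <- Eq. field. lra. }
  assert (Ea2 : a2 = 2 * (c + 1) * r / b).
  { unfold a2, y2, hyper. rewrite Ech, Esh, Ec, <- Eq. field. lra. }
  assert (Ed1 : d1 = a / b - (2 * c + 1) / b + 2 * c * b / r).
  { unfold d1. rewrite Ea1. unfold y1', y1, hyper, hyper', a.
    rewrite Eks, Ech, Esh, Ec, <- Eq. field. lra. }
  assert (Ed2 : d2 = a).
  { unfold d2. rewrite Ea2. unfold y2', y2, hyper, hyper', a.
    rewrite Ech, Esh, Ec, <- Eq. field. lra. }
  exists (fun p => (exit_angle hI mu b x0 S p, reflected_angle hI mu b x0 S p)).
  split; [|split; [|split; [|split]]].
  - apply return_map_near_0; auto.
    + apply (continuous_locally_pos (fun p => let w := arc_pos hI mu b x0 (S p) p in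
                                              fst (w * w)%C - x0)).
      * cbn [fst Cmult]. apply cont_minus; [|apply continuous_const].
        apply cont_minus; now apply cont_mult.
      * cbn [fst Cmult]. rewrite X0, Y0. unfold r in *. nra.
    + apply (continuous_locally_neg (fun p => dot (exit_speed hI mu b x0 S p)
                (inward_normal (ellipse b x0) (exit_angle hI mu b x0 S p)))).
      * unfold dot. apply cont_plus; apply cont_mult; auto.
        exact (slopes_continuous _ _ _ Sv2).
      * unfold dot. rewrite Ev1, Xi0, inward_normal_ellipse_0 by exact Hb.
        cbn [fst snd]. lra.
  - now rewrite Xi0, (slopes_0 _ _ _ SAl).
  - rewrite <- Ea1, <- Ea2. exact (slopes_differentiable _ _ _ SXi).
  - rewrite <- Ed1, <- Ed2. exact (slopes_differentiable _ _ _ SAl).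
  - unfold a. field. lra.
Qed.

(** * The half-turn exchanging the two vertices *)

Lemma inner_motion_opp (hI mu : R) (z v : R -> C) :
  inner_motion hI mu z v ->
  inner_motion hI mu (fun t => - z t)%C (fun t => - v t)%C.
Proof.
  intros [N [w [w' [tm [L Surj]]]]]. split.
  - intros t Hz. assert (Hz' : z t <> 0%C).
    { intros Z. apply Hz. rewrite Z. ring. }
    destruct (N t Hz') as [D1 [D2 E]]. split; [|split].
    + now apply is_derive_Copp.
    + replace (grad (V_I hI mu) (- z t)%C) with (- grad (V_I hI mu) (z t))%C.
      * now apply is_derive_Copp.
      * rewrite !grad_V_I by assumption. rewrite Cmod_opp.
        apply injective_projections; cbn [fst snd Copp]; unfold Rdiv; ring.
    + unfold V_I in *. now rewrite !Cmod_opp.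
  -
    (* The half-turn in the plane is the quarter-turn upstairs. *)
    assert (DC : forall (f : R -> C) s l, is_derive f s l ->
               is_derive (fun s => Ci * f s)%C s (Ci * l)%C).
    { intros f s l D. apply is_derive_C_iff in D. destruct D as [D1 D2].
      apply is_derive_C_iff. cbn [fst snd Cmult Ci]. split.
      - apply (is_derive_ext (fun s => - snd (f s))); 
          [intros r; match goal with |- @eq _ ?x ?y => change (@eq R x y) end; ring |].
        evar_last; [exact (is_derive_opp (fun s => snd (f s)) s (snd l) D2) |].
        unfold opp; simpl. ring.
      - apply (is_derive_ext (fun s => fst (f s))); 
          [intros r; match goal with |- @eq _ ?x ?y => change (@eq R x y) end; ring |].
        evar_last; [exact D1 | simpl; ring]. }
    exists (fun s => Ci * w s)%C, (fun s => Ci * w' s)%C, tm. split; [|exact Surj].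
    intros s. destruct (L s) as [D1 [D2 [D3 E]]]. split; [|split; [|split]].
    + now apply DC.
    + replace (RtoC (hI / 2) * (Ci * w s))%C with (Ci * (RtoC (hI / 2) * w s))%C by ring.
      now apply DC.
    + replace (Cmod (Ci * w s)%C) with (Cmod (w s)); [exact D3 |].
      unfold Cmod. cbn [fst snd Cmult Ci]. f_equal. ring.
    + rewrite E. apply injective_projections; cbn [fst snd Cmult Copp Ci]; ring.
Qed.

Lemma ellipse_half_turn (b x0 xi c : R) :
  cos c = -1 -> sin c = 0 -> ellipse b (- x0) (xi + c) = (- ellipse b x0 xi)%C.
Proof.
  intros Hc Hs. unfold ellipse. rewrite cos_plus, sin_plus, Hc, Hs.
  apply injective_projections; cbn [fst snd Copp]; ring.
Qed.

Lemma inward_normal_half_turn (b x0 xi c : R) :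
  cos c = -1 -> sin c = 0 ->
  inward_normal (ellipse b (- x0)) (xi + c) = (- inward_normal (ellipse b x0) xi)%C.
Proof.
  intros Hc Hs. unfold inward_normal.
  replace (tangent (ellipse b (- x0)) (xi + c)) with (- tangent (ellipse b x0) xi)%C.
  - rewrite Cmod_opp. unfold Cdiv. ring.
  - rewrite !tangent_ellipse, cos_plus, sin_plus, Hc, Hs.
    apply injective_projections; cbn [fst snd Copp]; ring.
Qed.

Lemma launch_half_turn (hI mu b x0 xi alpha c : R) :
  cos c = -1 -> sin c = 0 ->
  launch hI mu (ellipse b (- x0)) (xi + c) alpha
    = (- launch hI mu (ellipse b x0) xi alpha)%C.
Proof.
  intros Hc Hs. unfold launch.
  rewrite inward_normal_half_turn, ellipse_half_turn by assumption.
  unfold V_I. rewrite Cmod_opp. ring.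
Qed.

Lemma reflect_half_turn (b x0 xi c : R) (v : C) :
  cos c = -1 -> sin c = 0 ->
  reflect (ellipse b (- x0)) (xi + c) (- v)%C = (- reflect (ellipse b x0) xi v)%C.
Proof.
  intros Hc Hs. unfold reflect. rewrite inward_normal_half_turn by assumption.
  set (n := inward_normal (ellipse b x0) xi).
  replace (dot (- v)%C (- n)%C) with (dot v n) by (unfold dot; cbn [fst snd Copp]; ring).
  ring.
Qed.

Lemma first_return_half_turn (hI mu b x0 c : R) (p q : R * R) :
  cos c = -1 -> sin c = 0 ->
  first_return hI mu (ellipse b x0) (ellipse_interior b x0) p q ->
  first_return hI mu (ellipse b (- x0)) (ellipse_interior b (- x0))
    (fst p + c, snd p) (fst q + c, snd q).
Proof.
  intros Hc Hs [Hp [Hq [z [v [T [M [HT [Hz [Hv [HD [HzT HvT]]]]]]]]]]].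
  split; [exact Hp | split; [exact Hq |]]. cbn [fst snd].
  exists (fun t => - z t)%C, (fun t => - v t)%C, T.
  split; [now apply inner_motion_opp | split; [exact HT |]].
  rewrite !ellipse_half_turn, !launch_half_turn, reflect_half_turn by assumption.
  rewrite Hz, Hv, HzT, HvT.
  split; [reflexivity | split; [reflexivity | split; [| split; reflexivity]]].
  intros t Ht. specialize (HD t Ht). unfold ellipse_interior in *.
  cbn [fst snd Copp].
  replace (- fst (z t) - - x0) with (- (fst (z t) - x0)) by ring.
  replace (- snd (z t) / b) with (- (snd (z t) / b)) by (unfold Rdiv; ring).
  replace ((- (fst (z t) - x0)) ^ 2) with ((fst (z t) - x0) ^ 2) by ring.
  replace ((- (snd (z t) / b)) ^ 2) with ((snd (z t) / b) ^ 2) by ring.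
  exact HD.
Qed.

Lemma differentiable_pt_lim_shift (f : R -> R -> R) (h l1 l2 : R) :
  differentiable_pt_lim f 0 0 l1 l2 ->
  differentiable_pt_lim (fun x y => f (x - h) y) h 0 l1 l2.
Proof.
  intros D eps. destruct (D eps) as [d Hd]. exists d. intros u v Hu Hv.
  specialize (Hd (u - h) v). rewrite Rminus_diag. rewrite !Rminus_0_r in *.
  now apply Hd.
Qed.

Lemma differentiable_pt_lim_add_const (f : R -> R -> R) (x y h l1 l2 : R) :
  differentiable_pt_lim f x y l1 l2 ->
  differentiable_pt_lim (fun x y => f x y + h) x y l1 l2.
Proof.
  intros D eps. destruct (D eps) as [d Hd]. exists d. intros u v Hu Hv.
  replace (f u v + h - (f x y + h)) with (f u v - f x y) by ring. now apply Hd.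
Qed.

(** The half-turn conjugates the two return maps by a translation of [xi], which has
    no effect on derivatives. *)
Lemma return_jacobian_half_turn (hI mu b x0 j11 j12 j21 j22 : R) :
  return_jacobian hI mu (ellipse b x0) (ellipse_interior b x0) 0 j11 j12 j21 j22 ->
  return_jacobian hI mu (ellipse b (- x0)) (ellipse_interior b (- x0)) PI
    j11 j12 j21 j22.
Proof.
  intros [F [[d Hd] [F0 [D1 [D2 Det]]]]].
  exists (fun p => (fst (F (fst p - PI, snd p)) + PI, snd (F (fst p - PI, snd p)))).
  split; [|split; [|split; [|split; [|exact Det]]]].
  - exists d. intros [p1 p2] [Bp1 Bp2] [q1 q2]. cbn [fst snd] in *.
    assert (Bp : ball ((0, 0) : R * R) d (p1 - PI, p2)).
    { split; [|exact Bp2]. change (Rabs (p1 - PI - 0) < d).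
      rewrite Rminus_0_r. exact Bp1. }
    specialize (Hd _ Bp (q1 - PI, q2)). cbn [fst snd] in Hd.
    rewrite Rminus_0_r in Hd.
    assert (Shift : forall f : R * R,
              (q1 - PI, q2) = f <-> (q1, q2) = (fst f + PI, snd f)).
    { intros [f1 f2]. cbn [fst snd]. split; intros Eq; injection Eq as E1 E2;
        rewrite <- E2; f_equal; lra. }
    split.
    + intros [HF Hq]. apply Shift, Hd. split; [|exact Hq].
      rewrite <- (Ropp_involutive x0).
      apply (first_return_half_turn hI mu b (- x0) (- PI) (p1, p2) (q1, q2)); auto.
      * rewrite cos_neg. apply cos_PI.
      * rewrite sin_neg, sin_PI. ring.
    + intros Eq. apply Shift, Hd in Eq. destruct Eq as [HF Hq].
      split; [|exact Hq].
      apply (first_return_half_turn _ _ _ _ PI _ _ cos_PI sin_PI) in HF.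
      cbn [fst snd] in HF.
      assert (Back : forall u, u - PI + PI = u) by (intros u; ring).
      rewrite !Back in HF. exact HF.
  - cbn [fst snd]. rewrite Rminus_diag, F0. cbn [fst snd]. f_equal. ring.
  - cbn [fst snd].
    exact (differentiable_pt_lim_add_const _ _ _ PI _ _
             (differentiable_pt_lim_shift _ PI _ _ D1)).
  - cbn [fst snd]. exact (differentiable_pt_lim_shift _ PI _ _ D2).
Qed.

(** * Stability *)

Lemma central_configuration_0 (b x0 : R) :
  0 < b -> -1 < x0 < 1 -> central_configuration (ellipse b x0) 0.
Proof.
  intros Hb Hx. split.
  - rewrite tangent_ellipse. unfold dot, ellipse. cbn [fst snd].
    rewrite sin_0, cos_0. ring.
  - intros r eta Hr E. rewrite ellipse_0 in *. unfold ellipse in *.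
    pose proof (f_equal fst E) as E1. pose proof (f_equal snd E) as E2.
    cbn [fst snd Cmult RtoC] in E1, E2.
    pose proof (sin2_cos2 eta) as SC. unfold Rsqr in SC.
    assert (Z : sin eta = 0) by (apply (Rmult_eq_reg_l b); lra).
    rewrite Z in *. f_equal; [|ring].
    assert (0 <= r * (1 + x0)) by (apply Rmult_le_pos; lra). nra.
Qed.

Lemma central_configuration_half_turn (b x0 : R) :
  central_configuration (ellipse b x0) 0 ->
  central_configuration (ellipse b (- x0)) PI.
Proof.
  intros [O H].
  assert (EPI : forall xi, ellipse b (- x0) xi = (- ellipse b x0 (xi - PI))%C).
  { intros xi. rewrite <- (ellipse_half_turn b x0 (xi - PI) PI cos_PI sin_PI).
    f_equal. ring. }
  split.
  - rewrite tangent_ellipse in *. unfold dot, ellipse in *. cbn [fst snd] in *.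
    rewrite sin_PI, cos_PI. ring.
  - intros r eta Hr E. rewrite !EPI, Rminus_diag in *. f_equal. apply (H r _ Hr).
    transitivity (- - ellipse b x0 (eta - PI))%C; [ring | rewrite E; ring].
Qed.

(** The quantity [C_pi], as a function of the distance [r] from the mass to the
    vertex. *)
Definition stability_index (hI mu b r : R) : R :=
  (b ^ 2 / r - 1)
  * (b ^ 2 / r - 1 - b ^ 2 * mu / (2 * r ^ 2) * (1 / (hI + mu / r))).

(** The trace minus 2 is [4 (c + 1) (r / b^2 - 1)], and plus 2 it is
    [4 ((c + 1) r / b^2 - c)]. *)
Lemma discriminant_eq (hI mu b r : R) :
  0 < hI -> 0 < mu -> 0 < b -> 0 < r ->
  let c := 2 * (hI + mu / r) * r / mu - 1 in
  let a := 2 * (c + 1) * r / b ^ 2 - (2 * c + 1) in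
  (a + a) ^ 2 - 4 = (4 * ((c + 1) * r / b ^ 2)) ^ 2 * stability_index hI mu b r
  /\ 0 < (4 * ((c + 1) * r / b ^ 2)) ^ 2.
Proof.
  intros Hh Hm Hb Hr c a.
  assert (0 < hI * r) by now apply Rmult_lt_0_compat.
  split.
  - unfold a, c, stability_index. field. repeat split; lra.
  - apply pow_lt. apply Rmult_lt_0_compat; [lra |].
    apply Rdiv_lt_0_compat; [|nra].
    apply Rmult_lt_0_compat; [|exact Hr].
    unfold c. replace (2 * (hI + mu / r) * r / mu - 1 + 1) with (2 * (hI * r + mu) / mu)
      by (field; lra).
    apply Rdiv_lt_0_compat; lra.
Qed.

Lemma vertex_0_stability (hI mu b x0 : R) :
  0 < hI -> 0 < mu -> 0 < b -> -1 < x0 < 1 ->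
  let gamma := ellipse b x0 in
  let D := ellipse_interior b x0 in
  (stability_index hI mu b (1 + x0) > 0 -> unstable hI mu gamma D 0) /\
  (stability_index hI mu b (1 + x0) < 0 -> stable hI mu gamma D 0).
Proof.
  intros Hh Hm Hb Hx gamma D.
  destruct (discriminant_eq hI mu b (1 + x0) Hh Hm Hb ltac:(lra)) as [E P].
  pose proof (return_jacobian_0 hI mu b x0 Hh Hm Hb Hx) as J.
  cbv zeta in E, P, J.
  split; intros HC; (split; [now apply central_configuration_0 |]);
    do 4 eexists; (split; [exact J |]); rewrite E; nra.
Qed.

Lemma vertex_PI_stability (hI mu b x0 : R) :
  0 < hI -> 0 < mu -> 0 < b -> -1 < x0 < 1 ->
  let gamma := ellipse b x0 in
  let D := ellipse_interior b x0 in
  (stability_index hI mu b (1 - x0) > 0 -> unstable hI mu gamma D PI) /\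
  (stability_index hI mu b (1 - x0) < 0 -> stable hI mu gamma D PI).
Proof.
  intros Hh Hm Hb Hx gamma D.
  assert (Hx' : -1 < - x0 < 1) by lra.
  destruct (vertex_0_stability hI mu b (- x0) Hh Hm Hb Hx') as [U S].
  replace (1 - x0) with (1 + - x0) by ring. unfold gamma, D.
  rewrite <- (Ropp_involutive x0) at 2 3 5 6.
  split; intros HC; [apply U in HC | apply S in HC];
    destruct HC as [Cc [a [b' [c [d [J L]]]]]];
    (split; [now apply central_configuration_half_turn |]);
    exists a, b', c, d; (split; [now apply return_jacobian_half_turn | exact L]).
Qed.

(** Both factors are negative: at the farther vertex [b^2 < 1 <= r]. *)
Lemma stability_index_far (hI mu b r : R) :
  0 < hI -> 0 < mu -> 0 < b < 1 -> 1 <= r -> stability_index hI mu b r > 0.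
Proof.
  intros Hh Hm [Hb0 Hb1] Hr. unfold stability_index.
  assert (0 < mu / r) by (apply Rdiv_lt_0_compat; lra).
  assert (Pb : 0 < b ^ 2) by now apply pow_lt.
  assert (Pr : 0 < r ^ 2) by (apply pow_lt; lra).
  assert (H1 : b ^ 2 / r < 1) by (apply Rlt_div_l; nra).
  assert (H2 : 0 < b ^ 2 * mu / (2 * r ^ 2) * (1 / (hI + mu / r))).
  { apply Rmult_lt_0_compat; apply Rdiv_lt_0_compat; try lra.
    now apply Rmult_lt_0_compat. }
  nra.
Qed.

Lemma V_I_vertex_0 (hI mu b x0 : R) :
  -1 < x0 -> V_I hI mu (ellipse b x0 0) = hI + mu / (1 + x0).
Proof. intros Hx. unfold V_I. now rewrite ellipse_0, Cmod_pos_real by lra. Qed.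

Lemma V_I_vertex_PI (hI mu b x0 : R) :
  x0 < 1 -> V_I hI mu (ellipse b x0 PI) = hI + mu / (1 - x0).
Proof.
  intros Hx. replace (ellipse b x0 PI) with (- ellipse b (- x0) 0)%C.
  - replace (1 - x0) with (1 + - x0) by ring. rewrite <- (V_I_vertex_0 hI mu b) by lra.
    unfold V_I. now rewrite Cmod_opp.
  - rewrite <- (ellipse_half_turn b (- x0) 0 PI cos_PI sin_PI).
    now rewrite Ropp_involutive, Rplus_0_l.
Qed.

Theorem theorem6 (hI mu b x0 : R) (hI_pos : 0 < hI) (mu_pos : 0 < mu)
    (b_int : 0 < b < 1) :
  let gamma := ellipse b x0 in
  let D := ellipse_interior b x0 in
  let V := V_I hI mu in
  (0 <= x0 < 1 ->
     let C_pi :=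
       (b ^ 2 / (1 - x0) - 1)
       * (b ^ 2 / (1 - x0) - 1
          - b ^ 2 * mu / (2 * (1 - x0) ^ 2) * (1 / V (gamma PI))) in
     V (gamma PI) = hI + mu / (1 - x0) /\
     unstable hI mu gamma D 0 /\
     (C_pi > 0 -> unstable hI mu gamma D PI) /\
     (C_pi < 0 -> stable hI mu gamma D PI)) /\
  (-1 < x0 <= 0 ->
     let C_0 :=
       (b ^ 2 / (1 + x0) - 1)
       * (b ^ 2 / (1 + x0) - 1
          - b ^ 2 * mu / (2 * (1 + x0) ^ 2) * (1 / V (gamma 0))) in
     V (gamma 0) = hI + mu / (1 + x0) /\
     unstable hI mu gamma D PI /\
     (C_0 > 0 -> unstable hI mu gamma D 0) /\
     (C_0 < 0 -> stable hI mu gamma D 0)).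
Proof.
  intros gamma D V. destruct b_int as [b_pos b_lt].
  split; intros Hx.
  - assert (Hx' : -1 < x0 < 1) by lra.
    pose proof (V_I_vertex_PI hI mu b x0 (proj2 Hx')) as EV.
    fold V gamma in EV. rewrite EV.
    split; [reflexivity | split].
    + apply vertex_0_stability; auto. apply stability_index_far; auto; lra.
    + now apply vertex_PI_stability.
  - assert (Hx' : -1 < x0 < 1) by lra.
    pose proof (V_I_vertex_0 hI mu b x0 (proj1 Hx')) as EV.
    fold V gamma in EV. rewrite EV.
    split; [reflexivity | split].
    + apply vertex_PI_stability; auto. apply stability_index_far; auto; lra.
    + now apply vertex_0_stability.
Qed.
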